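(* Consider the single-server ($K=1$) task-based flow-time-plus-energy problem described in the context, with power function $P(s)=s^\alpha$ where $1<\alpha<2$. Then the online algorithm described in the context has competitive ratio at most $8+\frac{4}{2-\alpha}+3^{\alpha}$.
   Context: Model: a single server that may process several tasks simultaneously, each task $x$ being processed at its own rate $s_x(t)$; the server's total speed is $s(t)=\sum_x s_x(t)$ and it consumes power $P(s(t))$. A finite set of jobs is given; job $i$ is released at time $a_i$ and consists of $m_i$ map tasks and $\mathsf r$ reduce tasks with arbitrary positive sizes (work); every job has the same number $\mathsf r$ of reduce tasks (a standing assumption of this setting). MapReduce constraint: a reduce task of job $i$ may be processed only after all map tasks of job $i$ are completed; a reduce task is free once all map tasks of its job are completed. Preemption is allowed. The flow time of a task of job $i$ completed at time $c$ is $c-a_i$. The task-based cost is $\int n(t)\,dt+\int P(s(t))\,dt$, where $n(t)$ is the number of unfinished (map or reduce) tasks. An online algorithm learns about job $i$ only at time $a_i$. The competitive ratio of $A$ is $\sup_\sigma C^A(\sigma)/C^{\mathsf{OPT}}(\sigma)$, where $\mathsf{OPT}$ is the minimum cost over all feasible schedules chosen with full knowledge of the input. Algorithm: at time $t$ let $m(t)$ be the number of unfinished map tasks (over all jobs), $r_f(t)$ the number of unfinished free reduce tasks, and $J(t)$ the number of jobs with at least one unfinished map task. The cumulative remaining map size of a job is the sum of the remaining sizes of its map tasks. The algorithm simultaneously processes: ($M_1$) the unfinished map task with the smallest remaining size, at rate $P^{-1}(m(t)+1)$; ($M_2$) the shortest remaining map task of the job with the smallest cumulative remaining map size, at rate $P^{-1}(\mathsf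 r J(t)+1)$; ($R_f$) the free reduce task with the smallest remaining size, at rate $P^{-1}(r_f(t)+1)$. (If $M_1$ and $M_2$ coincide, only two tasks are processed.) The total speed is the sum of these rates. *)

(* Defs.v *)
From HB Require Import structures.
From mathcomp Require Import all_boot all_order all_algebra.
From mathcomp Require Import all_classical all_reals all_analysis.
Set Implicit Arguments. Unset Strict Implicit. Unset Printing Implicit Defensive.
Import Order.TTheory GRing.Theory Num.Theory.

Local Open Scope ring_scope.

(* Single-server MapReduce instance:
   T     : finite type of tasks,  J : finite type of jobs,
   job x : the job task x belongs to,  ismap x : x is a map task (else reduce),
   size x: work of task x,  rel j : release time a_j of job j.
   A schedule s gives the rate s x t at which task x is processed at time t;
   the server speed is \sum_x s x t and the power is (speed)^alpha. *)
Section MapReduce.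
Variables (R : realType) (T J : finType) (job : T -> J) (ismap : T -> bool)
  (size : T -> R) (rel : J -> R).

Definition schedule := T -> R -> R.

Definition work (s : schedule) (x : T) (t : R) : R :=
  Rintegral lebesgue_measure [set u | u <= t]%classic (s x).

Definition feasible (s : schedule) : Prop :=
  [/\ (forall x, measurable_fun setT (s x)),
      (forall x t, 0 <= s x t),
      (forall x t, t < rel (job x) -> s x t = 0),
      (forall x, (\int[lebesgue_measure]_(t in setT) (s x t)%:E)%E = (size x)%:E) &
      (forall x t, ~~ ismap x -> s x t != 0 ->
         forall y, ismap y -> job y = job x -> size y <= work s y t)].

Definition unfinished (s : schedule) (x : T) (t : R) : bool :=
  (rel (job x) <= t) && (work s x t < size x).

Definition n_unfinished (s : schedule) (t : R) : nat :=
  #|[set x | unfinished s x t]|.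

Definition cost (alpha : R) (s : schedule) : \bar R :=
  (\int[lebesgue_measure]_(t in setT) ((n_unfinished s t)%:R)%:E
   + \int[lebesgue_measure]_(t in setT) ((\sum_x s x t) `^ alpha)%:E)%E.

Definition opt_cost (alpha : R) : \bar R :=
  ereal_inf [set cost alpha s | s in feasible]%classic.

Definition rem (s : schedule) (x : T) (t : R) : R := size x - work s x t.

Definition mapU (s : schedule) (t : R) : {set T} :=
  [set x | ismap x && unfinished s x t].

Definition freeR (s : schedule) (t : R) : {set T} :=
  [set x | ~~ ismap x && unfinished s x t &&
     [forall y, (ismap y && (job y == job x)) ==> (size y <= work s y t)]].

Definition Jcount (s : schedule) (t : R) : nat :=
  #|[set j | [exists x, (x \in mapU s t) && (job x == j)]]|.

Definition cum (s : schedule) (j : J) (t : R) : R :=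
  \sum_(y in mapU s t | job y == j) rem s y t.

Definition Pinv (alpha z : R) : R := z `^ (alpha^-1).

(* s follows the rules (M1), (M2), (R_f) at every time t, with arbitrary
   tie-breaking; o1, o2, orf are the tasks selected by M1, M2, R_f.  If M1 and
   M2 select the same task it receives both rates. *)
Definition follows_alg (alpha : R) (r : nat) (s : schedule) : Prop :=
  forall t, exists o1 o2 orf : option T,
  [/\ [/\ (o1 == None) = (mapU s t == finset.set0),
          (o2 == None) = (mapU s t == finset.set0) &
          (orf == None) = (freeR s t == finset.set0)],
      (forall x1, o1 = Some x1 ->
         x1 \in mapU s t /\ forall y, y \in mapU s t -> rem s x1 t <= rem s y t),
      (forall x2, o2 = Some x2 ->
         [/\ x2 \in mapU s t,
             forall y, y \in mapU s t -> cum s (job x2) t <= cum s (job y) t &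
             forall y, y \in mapU s t -> job y = job x2 -> rem s x2 t <= rem s y t]),
      (forall xf, orf = Some xf ->
         xf \in freeR s t /\ forall y, y \in freeR s t -> rem s xf t <= rem s y t) &
      forall x, s x t =
          (o1 == Some x)%:R * Pinv alpha (#|mapU s t|.+1)%:R
        + (o2 == Some x)%:R * Pinv alpha ((r * Jcount s t).+1)%:R
        + (orf == Some x)%:R * Pinv alpha (#|freeR s t|.+1)%:R].

Definition alg_schedule (alpha : R) (r : nat) (s : schedule) : Prop :=
  feasible s /\ follows_alg alpha r s.

End MapReduce.

(* Main.v *)
(** Let A1, A2, A3 be the integrals of the number of unfinished map tasks, of [r]
    times the number of jobs with unfinished map tasks, and of the number of free
    reduce tasks of the algorithm.  Each is bounded by the cost of an arbitrary
    feasible schedule through one estimate for "shortest remaining first" rules.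

    Fix a level [q] and let tau_i and sigma_i be the times at which the remaining
    work of item [i] drops below [q] in the algorithm and in the other schedule.
    Read backwards in time, every tau_i raises and every sigma_i lowers the excess
    of the algorithm over the other schedule; the sum of a nondecreasing function
    of the excess over the raising events is therefore at most its sum over the
    lowering events.  Integrating over [q] and changing variables from [q] to time
    turns this into the inequality [srpt_potential].  With the potential increment
    n^(1-1/alpha), Young's inequality gives, for M and Q the numbers of unfinished
    map and reduce tasks and E the energy of the other schedule (integrated),
      A1 <= alpha M + E,  A2 <= alpha Q + E,
      A3 <= alpha Q + E + (alpha - 1) A2.
    Convexity bounds the cost of the algorithm by (1 + 2 3^(alpha-1)) (A1 + A2 + A3). *)

Require Import Defs.
From HB Require Import structures.
From mathcomp Require Import all_boot all_order all_algebra.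
From mathcomp Require Import all_classical all_reals all_analysis.
From mathcomp Require Import measurable_realfun ring lra zify.
Set Implicit Arguments. Unset Strict Implicit. Unset Printing Implicit Defensive.
Import Order.TTheory GRing.Theory Num.Theory.

Local Open Scope ring_scope.

(** * Interleaved events *)

Section EventBalance.
Variables (R : realType) (I : finType) (A : pred I) (tau sig : I -> R).
Variables (canon : pred I) (Dl : int -> R).
Hypothesis canon_inj : forall i j, A i -> A j -> canon i -> canon j ->
  tau i = tau j -> i = j.
Hypothesis Dl0 : forall n, n <= 0 -> Dl n = 0.
Hypothesis Dl_mono : forall m n, m <= n -> Dl m <= Dl n.

(** The excess of raising over lowering events, with and without those at time [t] itself. Read
    backwards, a raising event is charged after the whole jump at its time, a lowering event before
    it. *)
Let dge (t : R) : int := \sum_(j | A j) ((t <= tau j)%R%:R - (t <= sig j)%R%:R).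
Let dgt (t : R) : int := \sum_(j | A j) ((t < tau j)%R%:R - (t < sig j)%R%:R).

(** The potential: a discrete primitive of [Dl]. Since [Dl] vanishes on nonpositive integers, the
    value 0 on negative ones makes [FS] valid on all of [int]. *)
Let F (n : int) : R := match n with Posz m => \sum_(i < m) Dl i.+1%:Z | Negz _ => 0 end.

Let Dl_ge0 n : 0 <= Dl n.
Proof.
case: (leP n 0) => [/Dl0->//|/ltW n0].
by rewrite -(Dl0 (lexx 0)); exact: Dl_mono.
Qed.

Let FS n : F (n + 1) = F n + Dl (n + 1).
Proof.
case: n => [m|m] /=.
  by rewrite -PoszD addn1 /= big_ord_recr.
rewrite add0r; case: m => [|m].
  have -> : Negz 0 + 1 = 0 by [].
  by rewrite /= big_ord0 Dl0.
have -> : Negz m.+1 + 1 = Negz m by lia.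
by rewrite /= Dl0.
Qed.

Let F_up u (x : int) : F x <= F (x + u%:Z).
Proof.
elim: u => [|u IH]; first by rewrite addr0.
by rewrite -addn1 PoszD addrA FS (le_trans IH)// lerDl.
Qed.

Let F_down w (D : int) : F D - Dl D *+ w <= F (D - w%:Z).
Proof.
elim: w => [|w IH]; first by rewrite mulr0n !subr0.
have -> : D - w.+1%:Z = D - w%:Z - 1 by lia.
have := FS (D - w%:Z - 1); rewrite subrK => e.
rewrite mulrS opprD addrCA -lerBrDl opprK.
rewrite (le_trans IH)// e lerD2l; apply: Dl_mono; lia.
Qed.

(** This is the passage of one time with [u] raising and [w] lowering events. Each lowering step
    costs at most [Dl D] of potential, and the last raising step gains exactly [Dl (D + u - w)],
    which pays for a single charge. *)
Let F_step u w (D : int) :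
  (0 < u)%N%:R * Dl (D + u%:Z - w%:Z) + F D <= Dl D *+ w + F (D + u%:Z - w%:Z).
Proof.
have H := F_down w D.
have e : D + u%:Z - w%:Z = D - w%:Z + u%:Z by lia.
rewrite e; case: u {e} => [|u] /=.
  by rewrite mul0r add0r addr0 -lerBlDl.
rewrite mul1r.
have -> : D - w%:Z + u.+1%:Z = D - w%:Z + u%:Z + 1 by lia.
have := le_trans H (F_up u _); rewrite FS.
by set x := _ *+ w; lra.
Qed.

Let ev (e : I + I) : R := match e with inl i => tau i | inr i => sig i end.
Let Aev (e : I + I) : bool := match e with inl i => A i | inr i => A i end.

(* Induction on the number of events after [t]: step to the first one. *)
Let balance_gt N (t : R) : (#|[pred e | Aev e && (t < ev e)%R]| <= N)%N ->
  \sum_(i | A i && canon i && (t < tau i)) Dl (dge (tau i)) <=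
  \sum_(i | A i && (t < sig i)) Dl (dgt (sig i)) + F (dgt t).
Proof.
elim: N t => [|N IH] t.
  rewrite leqn0 => /eqP/card0_eq E.
  have Et i : A i -> (t < tau i) = false by move=> Ai; have := E (inl i); rewrite !inE /= Ai.
  have Es i : A i -> (t < sig i) = false by move=> Ai; have := E (inr i); rewrite !inE /= Ai.
  rewrite big1 ?big1; last 2 first.
  - by move=> i /andP[/Es->].
  - by move=> i /andP[/andP[/Et->]].
  rewrite (_ : dgt t = 0) ?add0r /= ?big_ord0 //.
  by apply: big1 => i Ai; rewrite Et// Es// subrr.
move=> cN.
have [e0 Pe0|E] := pickP [pred e | Aev e && (t < ev e)]; last first.
  by apply: (le_trans (IH t _)) => //; rewrite (eq_card0 E).
case: (@arg_minP _ R _ e0 [pred e | Aev e && (t < ev e)] ev Pe0) => e1 /=.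
set t0 := ev e1 => /andP[Ae1 te1] mn.
have gtE (x : R) : (forall e, Aev e -> x = ev e -> (t < x) = (t0 <= x)).
  move=> e Ae ->; apply/idP/idP => h; first by apply: mn; rewrite Ae h.
  exact: lt_le_trans te1 h.
have tauE i : A i -> (t < tau i) = (t0 <= tau i) by move=> Ai; apply: (gtE _ (inl i)).
have sigE i : A i -> (t < sig i) = (t0 <= sig i) by move=> Ai; apply: (gtE _ (inr i)).
have dE : dgt t = dge t0 by apply: eq_bigr => i Ai; rewrite tauE// sigE.
pose u := #|[pred i | A i && (tau i == t0)]|.
pose w := #|[pred i | A i && (sig i == t0)]|.
have dE' : dge t0 = dgt t0 + u%:Z - w%:Z.
  have sE (p : pred I) :
      #|[pred i | A i && p i]|%:Z = \sum_(i | A i) (p i)%:R :> int.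
    rewrite -sum1_card -natz natr_sum big_mkcondr/=.
    by apply: eq_bigr => i _; case: (p i).
  rewrite /u /w !sE /dge /dgt -big_split -sumrB; apply: eq_bigr => i _ /=.
  rewrite !le_eqVlt [t0 == tau i]eq_sym [t0 == sig i]eq_sym.
  by case: (ltgtP (tau i) t0); case: (ltgtP (sig i) t0).
(* By [canon_inj] at most one canonical raising event happens at [t0]; [F_step] pays for only
   one. *)
have L1 : \sum_(i | A i && canon i && (t < tau i)) Dl (dge (tau i)) <=
    \sum_(i | A i && canon i && (t0 < tau i)) Dl (dge (tau i)) + (0 < u)%N%:R * Dl (dge t0).
  rewrite (bigID (fun i => t0 < tau i)) /= lerD//.
    rewrite le_eqVlt; apply/orP; left; apply/eqP; apply: eq_bigl => i.
    case: (boolP (A i)) => //= Ai; rewrite -!andbA; congr andb.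
    by case: (ltP t0 (tau i)) => h; rewrite ?andbF// andbT (lt_trans te1 h).
  pose P := [pred i | A i && canon i && (t < tau i) && ~~ (t0 < tau i)].
  have PE i : P i -> [/\ A i, canon i & tau i = t0].
    move=> /andP[/andP[/andP[Ai ci] ti] ti0]; split => //.
    by apply/eqP; rewrite eq_le -tauE// ti leNgt ti0.
  have [i0 Pi0|P0] := pickP P; last first.
    by rewrite big_pred0 ?mulr_ge0.
  have [Ai0 ci0 ti0] := PE _ Pi0.
  rewrite (big_pred1 i0) ?ti0.
    rewrite (_ : (0 < u)%N) ?mul1r//; apply/card_gt0P; exists i0.
    by rewrite inE Ai0 ti0 eqxx.
  move=> i; apply/idP/eqP => [Pi|->//].
  by have [Ai ci ti] := PE i Pi; apply: canon_inj; rewrite ?ti ?ti0.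
have R1 : \sum_(i | A i && (t < sig i)) Dl (dgt (sig i)) =
    \sum_(i | A i && (t0 < sig i)) Dl (dgt (sig i)) + Dl (dgt t0) *+ w.
  rewrite (bigID (fun i => t0 < sig i)) /=; congr (_ + _).
    apply: eq_bigl => i; case: (boolP (A i)) => //= Ai.
    by case: (ltP t0 (sig i)) => h; rewrite ?andbF// andbT (lt_trans te1 h).
  rewrite /w -sumr_const; apply: eq_big => i.
    rewrite inE; case: (boolP (A i)) => //= Ai.
    by rewrite sigE// -leNgt eq_le andbC.
  move=> /andP[/andP[Ai si] si0]; congr (Dl (dgt _)).
  by apply/eqP; rewrite eq_le -sigE// si leNgt si0.
have /IH IH0 : (#|[pred e | Aev e && (t0 < ev e)%R]| <= N)%N.
  rewrite -ltnS; apply: leq_trans cN; apply: proper_card; apply/properP; split.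
    by apply/fintype.subsetP => e; rewrite !inE => /andP[-> /(lt_trans te1)->].
  by exists e1; rewrite !inE ?Ae1 ?te1//= ltxx.
have K := F_step u w (dgt t0); rewrite -dE' in K.
by rewrite (le_trans L1)// R1 dE; move: K; set x := _ *+ w; lra.
Qed.

Lemma event_balance :
  \sum_(i | A i && canon i) Dl (\sum_(j | A j) ((tau i <= tau j)%R%:R - (tau i <= sig j)%R%:R))
  <= \sum_(i | A i) Dl (\sum_(j | A j) ((sig i < tau j)%R%:R - (sig i < sig j)%R%:R)).
Proof.
(* A time before every event, where the excess and the potential are 0. *)
pose t := - \sum_i (`|tau i| + `|sig i|) - 1.
have sm i : `|tau i| + `|sig i| <= \sum_j (`|tau j| + `|sig j|).
  by rewrite (bigD1 i) //= lerDl sumr_ge0// => j _; rewrite addr_ge0.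
have tt i : t < tau i.
  have := sm i; have := ler_norm (- tau i); rewrite normrN.
  by have := normr_ge0 (sig i); rewrite /t; lra.
have ts i : t < sig i.
  have := sm i; have := ler_norm (- sig i); rewrite normrN.
  by have := normr_ge0 (tau i); rewrite /t; lra.
have := @balance_gt _ t (leqnn _).
rewrite (_ : dgt t = 0) /= ?big_ord0 ?addr0; last first.
  by apply: big1 => i _; rewrite tt ts subrr.
congr (_ <= _); apply: eq_bigl => i; rewrite ?tt ?ts andbT //.
Qed.
End EventBalance.

(** * Change of variables from remaining work to time *)

Section Rate.
Local Open Scope classical_set_scope.
Variables (R : realType) (a : R -> R) (z rho : R).
Hypothesis ma : measurable_fun setT a.
Hypothesis a_ge0 : forall t, 0 <= a t.
Hypothesis a_rel : forall t, t < rho -> a t = 0.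
Hypothesis a_int : (\int[lebesgue_measure]_(t in setT) (a t)%:E)%E = z%:E.
Local Notation mu := (@lebesgue_measure R).

(** The measure of work: Lebesgue measure with density [a]. Its distribution function is
    [served]. *)
Let nu (E : set (measurableTypeR R)) : \bar R := (\int[mu]_(t in E) (a t)%:E)%E.

Let mae : measurable_fun setT (EFin \o a).
Proof. exact/measurable_EFinP. Qed.

Let nu0 : nu set0 = 0%E. Proof. by rewrite /nu integral_set0. Qed.
Let nu_ge0 E : (0 <= nu E)%E.
Proof. by apply: integral_ge0 => t _; rewrite lee_fin. Qed.
Let nu_sigma : semi_sigma_additive nu.
Proof. by apply: semi_sigma_additive_nng_induced => // t; rewrite lee_fin. Qed.

HB.instance Definition _ := isMeasure.Build _ _ _ nu nu0 nu_ge0 nu_sigma.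

Let nuT : nu setT = z%:E. Proof. exact: a_int. Qed.

Let nu_fin : fin_num_fun nu.
Proof.
move=> E mE; rewrite ge0_fin_numE//; apply: (@le_lt_trans _ _ (nu setT)).
  by apply: le_measure; rewrite ?inE.
by rewrite nuT ltry.
Qed.
HB.instance Definition _ := Measure_isFinite.Build _ _ _ nu nu_fin.

Let nu_dom : nu `<< mu.
Proof.
apply/null_content_dominatesP => E mE E0.
rewrite /nu; apply: null_set_integral => //.
exact: measurable_funTS.
Qed.

(** The Radon-Nikodym derivative of [nu] has the same integral as [a] over every measurable set, so
    the two agree almost everywhere. *)
Let density_integral (g : R -> \bar R) : (forall t, 0 <= g t)%E ->
  measurable_fun setT g ->
  (\int[nu]_t g t = \int[mu]_t (g t * (a t)%:E))%E.
Proof.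
move=> g0 mg; rewrite -(Radon_Nikodym_SigmaFinite.change_of_variables nu_dom)//.
have I := Radon_Nikodym_SigmaFinite.f_integrable nu_dom.
apply: ae_eq_integral => //.
- by apply: emeasurable_funM => //; exact: measurable_int I.
- exact: emeasurable_funM.
- apply: ae_eqe_mul2l; apply: integral_ae_eq => //.
  by move=> E _ mE; rewrite -Radon_Nikodym_SigmaFinite.f_integral.
Qed.

Definition served (t : R) : R := Rintegral mu [set u | u <= t] a.

Let servedE t : (served t)%:E = nu `]-oo, t].
Proof.
rewrite /served /Rintegral (_ : [set u | u <= t] = `]-oo, t]); last first.
  by apply/seteqP; split => u; rewrite /= in_itv.
by rewrite fineK // nu_fin.
Qed.

Lemma EFin_served t : (served t)%:E = (\int[mu]_(u in [set u | (u <= t)%R]) (a u)%:E)%E.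
Proof.
by rewrite servedE /nu; congr (integral _ _ _).
Qed.

Lemma served_ge0 t : 0 <= served t. Proof. by rewrite -lee_fin servedE. Qed.

Lemma served_mono : {homo served : s t / s <= t}.
Proof.
move=> s t st; rewrite -lee_fin !servedE; apply: le_measure; rewrite ?inE//.
by apply: subset_itvl; rewrite bnd_simp.
Qed.

Lemma served_le t : served t <= z.
Proof. by rewrite -lee_fin servedE -nuT; apply: le_measure; rewrite ?inE. Qed.

Lemma measurable_served : measurable_fun setT served.
Proof. apply: nondecreasing_measurable => //; exact: served_mono. Qed.

(** [nu] has no atoms, so the endpoint carries no mass. *)
Let nu_lt t : nu `]-oo, t[ = (served t)%:E.
Proof.
rewrite servedE /nu (@integral_itv_bndo_bndc _ -oo%O t)//.
exact: measurable_funTS.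
Qed.

Let nu_ge t : nu `[t, +oo[ = (z - served t)%:E.
Proof.
have -> : `[t, +oo[ = setT `\` (`]-oo, t[ : set (measurableTypeR R)).
  by rewrite setTD setCitvl.
rewrite measureD//; last by rewrite ltey_eq nu_fin.
by rewrite setTI EFinB; congr (_ - _)%E; [exact: nuT|exact: nu_lt].
Qed.

Let nu_bigcup_le (F : (set (measurableTypeR R))^nat) c :
  (forall n, measurable (F n)) -> nondecreasing_seq F -> (forall n, nu (F n) <= c)%E ->
  (nu (\bigcup_n F n) <= c)%E.
Proof.
move=> mF ndF Fc.
have cv := nondecreasing_cvg_mu (mu := nu) mF (bigcupT_measurable F mF) ndF.
rewrite -(cvg_lim _ cv)//; apply: lime_le; first by apply/cvg_ex; eexists; exact: cv.
exact: nearW.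
Qed.

(** Left continuity, in the form that shows the supremum in [passage] to be attained; it follows
    from continuity of [nu] from below. *)
Lemma served_left_cont t c : (forall s, s < t -> served s <= c) -> served t <= c.
Proof.
move=> H; rewrite -lee_fin -nu_lt.
pose F n : set (measurableTypeR R) := `]-oo, t - n.+1%:R^-1].
have -> : `]-oo, t[ = \bigcup_n F n.
  apply/seteqP; split => s; last first.
    move=> [n _]; rewrite /F /= !in_itv /= => /le_lt_trans; apply.
    by rewrite ltrBlDr ltrDl invr_gt0.
  rewrite /= in_itv /= => st.
  have [n hn] := ltr_add_invr st.
  by exists n => //; rewrite /F /= in_itv /= lerBrDr ltW.
apply: nu_bigcup_le.
- by move=> n; exact: measurable_itv.
- move=> m n mn; apply/subsetPset; apply: subset_itvl; rewrite bnd_simp.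
  by rewrite lerD2l lerN2 lef_pV2 ?posrE// ler_nat.
- by move=> n; rewrite -servedE lee_fin H// ltrBlDr ltrDl invr_gt0.
Qed.

Lemma served_lt_rel t : t < rho -> served t = 0.
Proof.
move=> tr; apply: EFin_inj; rewrite servedE /nu.
apply: integral0_eq => s; rewrite /= in_itv /= => st.
by rewrite a_rel// (le_lt_trans st).
Qed.

Lemma served_cvg c : c < z -> exists t, c < served t.
Proof.
move=> cz; apply: contrapT => /forallNP H.
have Hc t : served t <= c by rewrite leNgt; exact/negP/H.
suff : (nu setT <= c%:E)%E by rewrite nuT lee_fin leNgt cz.
pose F n : set (measurableTypeR R) := `]-oo, n%:R].
have -> : setT = \bigcup_n F n.
  apply/seteqP; split => // s _; exists (Num.truncn s).+1 => //.
  by rewrite /F /= in_itv /= ltW// truncnS_gt.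
apply: nu_bigcup_le.
- by move=> n; exact: measurable_itv.
- move=> m n mn; apply/subsetPset; apply: subset_itvl; rewrite bnd_simp.
  by rewrite ler_nat.
- by move=> n; rewrite -servedE lee_fin.
Qed.

(* The last time with at least [q] units of work left; 0 is a junk value. *)
Definition passage (q : R) : R :=
  if (0 < q) && (q <= z) then sup [set t | q <= z - served t] else 0.

(** [passage] is adjoint to the remaining work because its supremum is attained. The set of times is
    nonempty since nothing is served before [rho], and bounded since more than [z - q] is eventually
    served, [q] being positive. *)
Lemma passageP q t : 0 < q -> q <= z -> (t <= passage q) = (q <= z - served t).
Proof.
move=> q0 qz; rewrite /passage q0 qz /=.
set S := [set t | _].
have S0 : S !=set0.
  by exists (rho - 1); rewrite /S /= served_lt_rel ?subr0// ltrBlDr ltrDl.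
have Sdown x y : S x -> y <= x -> S y.
  by rewrite /S /= => Sx yx; have := served_mono yx; lra.
have [b hb] : exists t, z - q < served t by apply: served_cvg; lra.
have Sub : has_ubound S.
  exists b => x Sx; rewrite leNgt; apply/negP => /ltW/served_mono.
  by move: Sx hb; rewrite /S /=; lra.
have supS : has_sup S by [].
have Ssup : S (sup S).
  suff : served (sup S) <= z - q by rewrite /S /=; lra.
  apply: served_left_cont => s ss.
  have /sup_adherent/(_ supS)[x Sx sx] : 0 < sup S - s by rewrite subr_gt0.
  have /(Sdown _ _ Sx) : s <= x by rewrite ltW//; move: sx; rewrite subKr.
  by rewrite /S /=; lra.
apply/idP/idP => [h|h]; first exact: Sdown Ssup h.
exact: ub_le_sup.
Qed.

Lemma measurable_passage : measurable_fun setT passage.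
Proof.
apply: (measurability (@RGenCInfty.G R)) => [|/= _ [_] [t] -> <-].
  exact: RGenCInfty.measurableE.
rewrite setTI.
(* For [t <= 0] the preimage also contains the levels outside []0, z]], which are sent to the junk
   value 0. *)
have -> : passage @^-1` `[t, +oo[ =
    `]0, Num.min z (z - served t)] `|` (if t <= 0 then ~` `]0, z] else set0).
  apply/seteqP; split => q; rewrite /= !in_itv /= andbT le_min.
    case: (boolP ((0 < q) && (q <= z))) => [/andP[q0 qz]|nq].
      by rewrite passageP// => ->; left; rewrite q0 qz.
    rewrite /passage (negbTE nq) => ->; right => /=; rewrite in_itv /=.
    exact/negP.
  case=> [/and3P[q0 qz h]|]; first by rewrite passageP.
  case: ifP => // t0 /=; rewrite in_itv /= => /negP nq.
  by rewrite /passage (negbTE nq).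
apply: measurableU => //; case: ifP => // _; exact: measurableC.
Qed.
HB.instance Definition _ :=
  isMeasurableFun.Build _ _ _ _ (passage : measurableTypeR R -> measurableTypeR R)
    measurable_passage.

(** [nu] is the image of Lebesgue measure on []0, z]] under [passage]: both give the ray [[t, +oo[]
    the mass [z - served t], and these rays form a generating pi-system exhausted by the rays [[- k,
    +oo[]. *)
Lemma integral_passage (g : R -> \bar R) : (forall t, 0 <= g t)%E ->
  measurable_fun setT g ->
  (\int[mu]_(t in setT) (g t * (a t)%:E) = \int[mu]_(q in `]0%R, z]) g (passage q))%E.
Proof.
move=> g0 mg.
have mD : measurable (`]0, z] : set (measurableTypeR R)) by [].
pose m1 := mrestr mu mD.
pose phi : measurableTypeR R -> measurableTypeR R := passage.
have E A : measurable A -> nu A = pushforward m1 phi A.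
  rewrite RGenCInfty.measurableE.
  apply: (@g_sigma_algebra_measure_unique _ R (measurableTypeR R) (@RGenCInfty.G R) _
     (fun k => `[- k%:R, +oo[)).
  - by move=> _ [t ->]; exact: measurable_itv.
  - by move=> k; exists (- k%:R).
  - apply/seteqP; split => // t _; exists (Num.truncn (- t)).+1 => //=.
    by rewrite in_itv /= andbT lerNl ltW// truncnS_gt.
  - move=> _ _ [s ->] [t ->]; exists (Num.max s t).
    by apply/seteqP; split => x; rewrite /= !in_itv /= !andbT ge_max => /andP.
  - move=> _ [t ->]; transitivity ((z - served t)%:E); first exact: nu_ge.
    transitivity (mu (`]0, z - served t] : set (measurableTypeR R))); last first.
      rewrite /= /pushforward /m1 /mrestr; congr (mu _); apply/esym.
      apply/seteqP; split => q; rewrite /= !in_itv /= andbT.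
        by move=> [+ /andP[q0 qz]]; rewrite passageP// => ->; rewrite q0.
      move=> /andP[q0 h]; have qz : q <= z.
        by rewrite (le_trans h)// gerBl served_ge0.
      by rewrite passageP// q0 qz.
    rewrite lebesgue_measure_itv /= lte_fin.
    case: ltP => [_|h]; first by rewrite sube0.
    by congr EFin; apply/eqP; rewrite eq_le h subr_ge0 served_le.
  - move=> k; rewrite ltey_eq; apply/orP; left; exact: nu_fin.
transitivity (\int[nu]_t g t)%E; first exact/esym/density_integral.
transitivity (\int[pushforward m1 phi]_t g t)%E.
  by apply: eq_measure_integral => A mA _; exact: E.
rewrite ge0_integral_pushforward// preimage_setT.
have mDC : measurable (~` `]0, z] : set (measurableTypeR R)) by exact: measurableC.
transitivity (\int[m1]_(q in setT `\` ~` `]0%R, z]) g (passage q))%E.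
  apply: ge0_negligible_integral => //.
  - by apply: measurableT_comp => //; exact: measurable_passage.
  - by move=> q _; exact: g0.
  - by transitivity (mu (~` `]0, z] `&` `]0, z])); [|rewrite setICl measure0].
rewrite setTD setCK; apply: (eq_measure_integral mu) => A mA AD.
by transitivity (mu (A `&` `]0, z])); [|rewrite setIidl].
Qed.

End Rate.

(** * Shortest remaining work first *)

Section MeasurableBool.
Variable R : realType.

Lemma measurable_forall (I : finType) (f : I -> R -> bool) :
  (forall i, measurable_fun setT (f i)) ->
  measurable_fun setT (fun t => [forall i, f i t]).
Proof.
move=> mf.
rewrite (_ : (fun _ => _) = fun t => all (fun i => f i t) (enum I)); last first.
  apply/funext => t; apply/forallP/allP => [h i _//|h i].
  by apply: h; rewrite mem_enum.
elim: (enum I) => [|i s IH] /=; first exact: measurable_cst.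
exact: measurable_and.
Qed.

Lemma measurable_natb (f : R -> bool) : measurable_fun setT f ->
  measurable_fun setT (fun t => (f t)%:R : R).
Proof.
move=> mf; rewrite (_ : (fun _ => _) = fun t => if f t then 1 else 0 : R).
  by apply: measurable_fun_ifT.
by apply/funext => t; case: (f t).
Qed.

Lemma measurable_sum_natb (I : finType) (f : I -> R -> bool) :
  (forall i, measurable_fun setT (f i)) ->
  measurable_fun setT (fun t => \sum_i (f i t)%:R : R).
Proof. by move=> mf; apply: measurable_sum => i; exact: measurable_natb. Qed.

End MeasurableBool.

Section IntegralSum.
Variables (R : realType) (D : set (measurableTypeR R)).
Hypothesis mD : measurable D.
Local Notation mu := (@lebesgue_measure R).

Lemma ge0_integral_sumr (I : finType) (f : I -> R -> R) :
  (forall i t, 0 <= f i t) -> (forall i, measurable_fun setT (f i)) ->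
  (\int[mu]_(t in D) (\sum_i f i t)%:E = \sum_i \int[mu]_(t in D) (f i t)%:E)%E.
Proof.
move=> f0 mf; rewrite -ge0_integral_sum//.
- by apply: eq_integral => t _; rewrite sumEFin.
- by move=> i; apply/measurable_EFinP; apply: measurable_funTS; exact: mf.
- by move=> i t _; rewrite lee_fin.
Qed.

End IntegralSum.

Section RateFamily.
Variables (R : realType) (I : finType) (a : I -> R -> R) (z rho : I -> R).
Local Notation mu := (@lebesgue_measure R).

Definition rate_family : Prop :=
  [/\ forall i, measurable_fun setT (a i),
      forall i t, 0 <= a i t,
      forall i t, t < rho i -> a i t = 0 &
      forall i, (\int[mu]_(t in setT) (a i t)%:E = (z i)%:E)%E].

Hypothesis H : rate_family.

(** Each item uses the levels []0, z i]]. Extending by 0 to all positive levels lets the sum go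
    inside the integral, so that the two schedules can be compared level by level. *)
Lemma integral_sum_passage (g : I -> R -> R) :
  (forall i t, 0 <= g i t) -> (forall i, measurable_fun setT (g i)) ->
  (\int[mu]_(t in setT) (\sum_i g i t * a i t)%:E =
   \int[mu]_(q in `]0%R, +oo[%classic) (\sum_(i | (q <= z i)%R) g i (passage (a i) (z i) q))%:E)%E.
Proof.
case: H => ma a0 arel aint g0 mg.
have mp i : measurable_fun setT (passage (a i) (z i)).
  exact: (measurable_passage (ma i) (a0 i) (arel i) (aint i)).
rewrite ge0_integral_sumr//; last 2 first.
- by move=> i t; rewrite mulr_ge0.
- by move=> i; exact: measurable_funM.
pose f i q := (q <= z i)%R%:R * g i (passage (a i) (z i) q).
transitivity (\int[mu]_(q in `]0%R, +oo[%classic) (\sum_i f i q)%:E)%E; last first.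
  apply: eq_integral => q _; congr EFin; rewrite [RHS]big_mkcond /=.
  by apply: eq_bigr => i _; rewrite /f; case: ifP => _; rewrite ?mul1r ?mul0r.
rewrite ge0_integral_sumr//; last 2 first.
- by move=> i t; rewrite mulr_ge0.
- move=> i; apply: measurable_funM; last exact: measurableT_comp.
  by apply: measurable_natb; exact: measurable_fun_ler.
apply: eq_bigr => i _.
transitivity (\int[mu]_(q in `]0%R, z i]%classic) (g i (passage (a i) (z i) q))%:E)%E.
  rewrite -(@integral_passage _ _ _ (rho i) (ma i) (a0 i) (arel i) (aint i) (fun t => (g i t)%:E)).
  - by [].
  - by move=> t; rewrite lee_fin.
  - exact/measurable_EFinP.
have -> : (`]0%R, z i] = `]0%R, +oo[ `&` `]-oo, z i] :> set R)%classic.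
  by apply/seteqP; split => q; rewrite /= !in_itv /= ?andbT; [move=> /andP[]|case=> -> ->].
rewrite integral_mkcondr; apply: eq_integral => q _; rewrite patchE.
rewrite mem_setE in_itv /= /f.
by case: ifP => _; rewrite ?mul1r ?mul0r.
Qed.
End RateFamily.

Section Pending.
Variables (R : realType) (I : finType) (z rho : I -> R).

Definition pending (c : I -> R -> R) (i : I) (t : R) : bool :=
  (rho i <= t) && (served (c i) t < z i).

Lemma measurable_pending d : rate_family d z rho ->
  measurable_fun setT (fun t => \sum_i (pending d i t)%:R : R).
Proof.
case=> mc c0 crel cint; apply: measurable_sum_natb => i; apply: measurable_and.
  exact: measurable_fun_ler.
by apply: measurable_fun_ltr => //; exact: (measurable_served (mc i) (c0 i) (cint i)).
Qed.

End Pending.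

Section SRPT.
Variables (R : realType) (I : finType) (a b : I -> R -> R) (z rho : I -> R).
Local Notation mu := (@lebesgue_measure R).
Hypotheses (Ha : rate_family a z rho) (Hb : rate_family b z rho).
Variables (k v h : R -> R).
Hypothesis mk : measurable_fun setT k.
Hypothesis mv : measurable_fun setT v.
Hypothesis v_ge0 : forall t, 0 <= v t.
Hypothesis h_mono : {homo h : x y / x <= y}.
Hypothesis h0 : forall x, x <= 0 -> h x = 0.

(** The last condition asks only how many released items have at least as much work left, not which
    items the rule selects from. Thus [k] may count just some of the unfinished items, as for free
    reduce tasks. *)
Definition shortest (i : I) (t : R) : bool :=
  [&& rho i <= t, served (a i) t < z i, v t <= a i t &
   k t <= \sum_j ((rho j <= t) && (z i - served (a i) t <= z j - served (a j) t))%R%:R].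

Hypothesis shortest_ex : forall t, 0 < k t -> exists i, shortest i t.

(* Ties are broken by [enum_rank], so that at most one item is charged at each time. *)
Let canon (i : I) (t : R) : bool :=
  shortest i t && [forall j, (enum_rank j < enum_rank i)%N ==> ~~ shortest j t].

Let mrel i : measurable_fun setT (fun t => rho i <= t).
Proof. by apply: measurable_fun_ler. Qed.

Let mserved c i : rate_family c z rho -> measurable_fun setT (served (c i)).
Proof. by case=> mc c0 crel cint; exact: (measurable_served (mc i) (c0 i) (cint i)). Qed.

Let mshortest i : measurable_fun setT (shortest i).
Proof.
have ms j : measurable_fun setT (fun t => z j - served (a j) t).
  by apply: measurable_funB => //; exact: mserved.
case: Ha => ma _ _ _.
apply: measurable_and => //; apply: measurable_and.
  by apply: measurable_fun_ltr => //; exact: mserved.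
apply: measurable_and; first exact: measurable_fun_ler.
apply: measurable_fun_ler => //; apply: measurable_sum_natb => j.
by apply: measurable_and => //; exact: measurable_fun_ler.
Qed.

Let mcanon i : measurable_fun setT (canon i).
Proof.
apply: measurable_and => //; apply: measurable_forall => j.
case: ltnP => _ /=; last exact: measurable_cst.
exact: measurable_neg.
Qed.

Let canon_uniq i j t : canon i t -> canon j t -> i = j.
Proof.
move=> /andP[si /forallP fi] /andP[sj /forallP fj].
apply: enum_rank_inj; apply/val_inj => /=.
case: (ltngtP (enum_rank i) (enum_rank j)) => // lt.
- by have := fj i; rewrite lt si.
- by have := fi j; rewrite lt sj.
Qed.

Let canon_ex t : 0 < k t -> exists i, canon i t.
Proof.
move=> /shortest_ex[i0 si0].
case: (@arg_minnP _ i0 (shortest ^~ t) (fun i => enum_rank i : nat) si0) => i si mi.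
exists i; rewrite /canon si; apply/forallP => j; apply/implyP => ji.
by apply/negP => /mi; rewrite leqNgt ji.
Qed.

Let h_ge0 x : 0 <= h x.
Proof. by case: (leP x 0) => [/h0->//|/ltW/h_mono]; rewrite (h0 (lexx 0)). Qed.

Let mh : measurable_fun setT h. Proof. exact: nondecreasing_measurable. Qed.

Let No t : R := \sum_i (pending z rho b i t)%:R.
Let Na t : R := \sum_i (pending z rho a i t)%:R.

(** [event_balance] at level [q]. When a canonical item passes the level in [a], at least [k]
    released items have [q] units left in [a] and at most [No] of them in [b], so the excess is at
    least [k - No]. When an item passes it in [b], the excess is at most [Na]. *)
Let level_balance q : 0 < q ->
  \sum_(i | q <= z i) (canon i (passage (a i) (z i) q))%:R *
      h (k (passage (a i) (z i) q) - No (passage (a i) (z i) q)) <=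
  \sum_(i | q <= z i) h (Na (passage (b i) (z i) q)).
Proof.
move=> q0; set tau := fun i => passage (a i) (z i) q.
set sig := fun i => passage (b i) (z i) q.
case: (Ha) (Hb) => ma a0 arel aint [mb b0 brel bint].
have tauP j t : q <= z j -> (t <= tau j) = (q <= z j - served (a j) t).
  exact: (passageP (ma j) (a0 j) (arel j) (aint j)).
have sigP j t : q <= z j -> (t <= sig j) = (q <= z j - served (b j) t).
  exact: (passageP (mb j) (b0 j) (brel j) (bint j)).
have sa0 j t : t < rho j -> served (a j) t = 0
  by exact: (served_lt_rel (ma j) (a0 j) (arel j) (aint j)).
have sb0 j t : t < rho j -> served (b j) t = 0
  by exact: (served_lt_rel (mb j) (b0 j) (brel j) (bint j)).
have sag j t : 0 <= served (a j) t by exact: (served_ge0 (ma j) (a0 j) (aint j)).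
pose Dl (n : int) := h n%:~R.
have Dl0 n : n <= 0 -> Dl n = 0 by move=> n0; apply: h0; rewrite -(mulr0z 1) ler_int.
have Dlm m n : m <= n -> Dl m <= Dl n by move=> mn; apply: h_mono; rewrite ler_int.
have cinj i j : q <= z i -> q <= z j -> canon i (tau i) -> canon j (tau j) ->
  tau i = tau j -> i = j by move=> _ _ ci cj e; apply: (canon_uniq ci); rewrite e.
have E := @event_balance R I (fun i => q <= z i) tau sig (fun i => canon i (tau i)) Dl cinj Dl0 Dlm.
apply: (le_trans _ (le_trans E _)).
  rewrite [leRHS]big_mkcondr /=; apply: ler_sum => i qi.
  case: (boolP (canon i (tau i))) => [/andP[/and4P[ri si _ ki] _]|]; last by rewrite mul0r.
  rewrite mul1r; apply: h_mono; rewrite -/(tau i).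
  rewrite lerBlDr (le_trans ki)// -lerBlDr -sumrB rmorph_sum /= [leRHS]big_mkcond /=.
  have qp : q <= z i - served (a i) (tau i) by rewrite -tauP.
  move: (tau i) ri si ki qp => t _ _ _ qp.
  apply: ler_sum => j _; rewrite rmorphB /= /pending.
  have := sag j t => saj.
  (* An item smaller than [q] has less work left than item [i], so it is not counted by [k]. *)
  case: (leP q (z j)) => [qj|jq]; last first.
    have -> : (z i - served (a i) t <= z j - served (a j) t) = false
      by apply/negbTE; rewrite -ltNge; lra.
    by rewrite andbF sub0r oppr_le0.
  rewrite tauP// sigP//.
  (* Before its release item [j] is untouched in both schedules and its two contributions cancel. *)
  case: (leP (rho j) t) => [rj|rj] /=; last first.
    by rewrite (sa0 j)// (sb0 j)// !subrr.
  have lb (x y : bool) : (x -> y) -> (x : nat)%:R <= (y : nat)%:R%:~R :> R.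
    by case: x; case: y => // /(_ isT).
  have lb' (x y : bool) : (x -> y) -> (x : nat)%:R%:~R <= (y : nat)%:R :> R.
    by case: x; case: y => // /(_ isT).
  apply: lerB; first by apply: lb; lra.
  by apply: lb'; lra.
apply: ler_sum => i qi; apply: h_mono; rewrite -/(sig i) /Na rmorph_sum /= [leLHS]big_mkcond /=.
move: (sig i) => t; apply: ler_sum => j _; rewrite rmorphB /= /pending.
case: (leP q (z j)) => [qj|//].
case: (leP (rho j) t) => [rj|rj] /=.
  have : (t < tau j) -> (served (a j) t < z j).
    by move=> /ltW; rewrite tauP//; lra.
  move=> imp; apply: (@le_trans _ _ ((t < tau j)%R%:R%:~R)).
    by rewrite gerBl; case: (t < sig j).
  by case: (t < tau j) imp => [->|]//; case: (_ < z j).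
suff -> : t < sig j by case: (t < tau j); rewrite ?subrr ?sub0r ?oppr_le0.
(* [sigP] yields only a weak inequality; a midpoint still before the release makes it strict. *)
apply: (@lt_le_trans _ _ ((t + rho j) / 2)); first lra.
by rewrite sigP// sb0 ?subr0//; lra.
Qed.

(** While [k] is positive, a canonical item runs at rate at least [v], so [v] can be replaced by the
    rates of canonical items. Changing variables from time to level on both sides leaves
    [level_balance]. *)
Lemma srpt_potential :
  (\int[mu]_(t in setT) (v t * h (k t - No t))%:E <=
   \int[mu]_(t in setT) ((\sum_i b i t) * h (Na t))%:E)%E.
Proof.
have mN : measurable_fun setT (fun t => h (k t - No t)).
  by apply: measurableT_comp => //; apply: measurable_funB => //; exact: (measurable_pending Hb).
have mNa : measurable_fun setT (fun t => h (Na t)).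
  by apply: measurableT_comp => //; exact: (measurable_pending Ha).
have mg i : measurable_fun setT (fun t => (canon i t)%:R * h (k t - No t)).
  by apply: measurable_funM => //; exact: measurable_natb.
case: (Ha) (Hb) => ma a0 arel aint [mb b0 brel bint].
have L : (\int[mu]_(t in setT) (v t * h (k t - No t))%:E <=
    \int[mu]_(t in setT) (\sum_i (canon i t)%:R * h (k t - No t) * a i t)%:E)%E.
  apply: ge0_le_integral => //.
  - by move=> t _; rewrite lee_fin mulr_ge0.
  - by apply/measurable_EFinP; exact: measurable_funM.
  - apply/measurable_EFinP; apply: measurable_sum => i.
    exact: (measurable_funM (mg i) (ma i)).
  - move=> t _; rewrite lee_fin.
    have p0 i : 0 <= (canon i t)%:R * h (k t - No t) * a i t by rewrite !mulr_ge0.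
    (* A canonical item may be missing when [k t <= 0], but then the charge is 0. *)
    case: (leP (k t) 0) => [k0|/canon_ex[i ci]].
      have hk : h (k t - No t) = 0 by apply: h0; rewrite subr_le0 (le_trans k0)// sumr_ge0.
      by rewrite hk mulr0; under eq_bigr do rewrite mulr0 mul0r; rewrite big1.
    rewrite (bigD1 i)//= ci mul1r ler_wpDr ?sumr_ge0//.
    by rewrite mulrC ler_wpM2l//; case/andP: ci => /and4P[].
apply: (le_trans L).
rewrite (integral_sum_passage Ha (g := fun i t => (canon i t)%:R * h (k t - No t)))//; last first.
  by move=> i t; rewrite mulr_ge0.
under [in leRHS]eq_integral do rewrite mulr_suml.
under [in leRHS]eq_integral do under eq_bigr do rewrite mulrC.
rewrite (integral_sum_passage Hb (g := fun i t => h (Na t)))//.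
have mpa i := measurable_passage (ma i) (a0 i) (arel i) (aint i).
have mpb i := measurable_passage (mb i) (b0 i) (brel i) (bint i).
have msum (f : I -> R -> R) : (forall i, measurable_fun setT (f i)) ->
    measurable_fun (`]0%R, +oo[%classic : set (measurableTypeR R))
      (fun q => (\sum_(i | (q <= z i)%R) f i q)%:E).
  move=> mf; apply/measurable_EFinP; apply: measurable_funTS.
  rewrite (_ : (fun _ => _) = fun q => \sum_i (q <= z i)%R%:R * f i q).
    apply: measurable_sum => i; apply: measurable_funM; last exact: mf.
    by apply: measurable_natb; exact: measurable_fun_ler.
  apply/funext => q; rewrite big_mkcond /=; apply: eq_bigr => i _.
  by case: ifP; rewrite ?mul1r ?mul0r.
apply: ge0_le_integral => //.
- by move=> q _; rewrite lee_fin sumr_ge0// => i _; rewrite mulr_ge0.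
- apply: (msum (fun i q => (canon i (passage (a i) (z i) q))%:R *
    h (k (passage (a i) (z i) q) - No (passage (a i) (z i) q)))) => i.
  exact: (measurableT_comp (mg i) (mpa i)).
- apply: (msum (fun i q => h (Na (passage (b i) (z i) q)))) => i.
  exact: (measurableT_comp mNa (mpb i)).
- by move=> q; rewrite /= in_itv /= andbT => q0; rewrite lee_fin level_balance.
Qed.

End SRPT.

(** * Power inequalities *)

Section PowerInequalities.
Variables (R : realType) (alpha : R).
Hypothesis alpha_gt1 : 1 < alpha.
Local Notation beta := (1 - alpha^-1).

Let alpha_gt0 : 0 < alpha. Proof. exact: lt_trans alpha_gt1. Qed.

Lemma conj_exponent_gt0 : 0 < beta.
Proof. by rewrite subr_gt0 invf_lt1. Qed.

Lemma young_powR (x y : R) : 0 <= x -> 0 <= y ->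
  x * y `^ beta <= alpha^-1 * x `^ alpha + beta * y.
Proof.
move=> x0 y0; have b0 := conj_exponent_gt0.
have := @conjugate_powR R x (y `^ beta) alpha (beta^-1) x0 (powR_ge0 _ _) alpha_gt0.
rewrite invr_gt0 invrK => /(_ b0); rewrite addrC subrK => /(_ erefl).
by rewrite -powRrM divff ?gt_eqF// powRr1// [_ * beta]mulrC [_ / alpha]mulrC.
Qed.

(** For positive [x], split it into its powers [alpha^-1] and [beta]. In [flow_bound] the first
    factor becomes the rate [v] and the second the potential increment [h]. *)
Lemma le_mul_powR_conj (k x : R) : x <= k ->
  x <= k `^ alpha^-1 * (Num.max x 0) `^ beta.
Proof.
move=> xk; case: (leP x 0) => [x0|x0].
  by rewrite (le_trans x0)// mulr_ge0// powR_ge0.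
have e : x = x `^ alpha^-1 * x `^ beta.
  by rewrite -powRD ?subrKC ?powRr1 ?ltW// oner_eq0.
rewrite {1}e ler_wpM2r ?powR_ge0// ge0_ler_powR ?nnegrE ?invr_ge0 ?(ltW x0) ?(ltW alpha_gt0)//.
exact: le_trans (ltW x0) xk.
Qed.

(** Young's inequality against the mean [m] bounds [u * m^(alpha - 1)] for each summand [u]; adding
    the three bounds gives [3 * m^alpha <= x^alpha + y^alpha + w^alpha]. *)
Lemma powR_sum3_le (x y w : R) : 0 <= x -> 0 <= y -> 0 <= w ->
  (x + y + w) `^ alpha <=
  3 `^ (alpha - 1) * (x `^ alpha + y `^ alpha + w `^ alpha).
Proof.
move=> x0 y0 w0.
have [m mE] : exists m, m = (x + y + w) / 3 by eexists.
have m0 : 0 <= m by rewrite mE divr_ge0// !addr_ge0.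
have e : (m `^ alpha) `^ beta = m `^ (alpha - 1).
  by rewrite -powRrM mulrBr mulr1 divff ?gt_eqF.
have yg u : 0 <= u -> u * m `^ (alpha - 1) <= alpha^-1 * u `^ alpha + beta * m `^ alpha.
  by move=> u0; rewrite -e young_powR// powR_ge0.
have mm : m * m `^ (alpha - 1) = m `^ alpha by rewrite mulr_powRB1.
have -> : x + y + w = 3 * m by rewrite mE; field.
rewrite powRM// -(@mulr_powRB1 _ 3 alpha)// [3 * _]mulrC -mulrA.
rewrite ler_wpM2l ?powR_ge0//.
have H1 := yg _ x0; have H2 := yg _ y0; have H3 := yg _ w0.
have S : x * m `^ (alpha - 1) + y * m `^ (alpha - 1) + w * m `^ (alpha - 1) = 3 * m `^ alpha.
  by rewrite -mm mE; field.
rewrite -(@ler_pM2l _ alpha^-1) ?invr_gt0//.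
lra.
Qed.

(** The chord bound for a convex exponential, obtained as Young's inequality for [3^(alpha - 1) * 1]
    with weights [alpha - 1] and [2 - alpha]. *)
Lemma powR3_le : alpha < 2 -> 3 `^ (alpha - 1) <= 1 + 2 * (alpha - 1).
Proof.
have a1 := alpha_gt1; move=> a2; have x0 : 0 < alpha - 1 by lra.
have x1 : 0 < 1 - (alpha - 1) by lra.
have := @conjugate_powR R (3 `^ (alpha - 1)) 1 (alpha - 1)^-1 (1 - (alpha - 1))^-1
  (powR_ge0 _ _) ler01.
rewrite !invr_gt0 !invrK subrKC => /(_ x0 x1 erefl).
by rewrite -powRrM divff ?gt_eqF// powRr1// powR1 mulr1; lra.
Qed.

(** The coefficients on the left arise by adding the bounds on the three flows after inserting the
    one on [A2] into the one on [A3]. The comparison is made coefficient by coefficient. *)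
Lemma competitive_constant (M Q E : R) : alpha < 2 ->
  0 <= M -> 0 <= Q -> 0 <= E ->
  (1 + 2 * 3 `^ (alpha - 1)) *
    (alpha * M + (alpha + alpha ^+ 2) * Q + (2 + alpha) * E) <=
  (8 + 4 / (2 - alpha) + 3 `^ alpha) * (M + Q + E).
Proof.
have a1 := alpha_gt1; move=> a2 M0 Q0 E0.
rewrite -(@mulr_powRB1 _ 3 alpha)//.
have y1 := powR3_le a2; have y0 : 0 <= 3 `^ (alpha - 1) := powR_ge0 _ _.
move: (3 `^ _) y0 y1 => y y0 y1.
suff [H1 H2 H3] : [/\ (1 + 2 * y) * alpha <= 8 + 4 / (2 - alpha) + 3 * y,
   (1 + 2 * y) * (alpha + alpha ^+ 2) <= 8 + 4 / (2 - alpha) + 3 * y &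
   (1 + 2 * y) * (2 + alpha) <= 8 + 4 / (2 - alpha) + 3 * y].
  by rewrite mulrDr mulrDr mulrDr mulrDr !mulrA !lerD// ler_wpM2r.
have [x xE] : exists x, x = alpha - 1 by eexists.
have -> : alpha = 1 + x by rewrite xE; ring.
have x0 : 0 < x by rewrite xE; lra.
have x1 : x < 1 by rewrite xE; lra.
rewrite -xE in y1.
have -> : 2 - (1 + x) = 1 - x by ring.
have q : 4 / (1 - x) * (1 - x) = 4 by rewrite divfK//; lra.
move: (4 / (1 - x)) q => f q.
(* A truncated geometric series for [4 / (1 - x)]. *)
have f4 : 4 + 4 * x + 4 * x ^+ 2 + 4 * x ^+ 3 <= f by nra.
(* This is the coefficient of [Q]: the left side is [(1 + 2 * y) * (2 + 3 * x + x^2) - 3 * y] with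
   [y] replaced by its upper bound [1 + 2 * x]. *)
have key : 3 + 11 * x + 15 * x ^+ 2 + 4 * x ^+ 3 <= 8 + f.
  rewrite -(@ler_pM2r _ (1 - x)); last lra.
  rewrite [leRHS]mulrDl q.
  have : 0 < 9 - 16 * x - 4 * x ^+ 2 + 11 * x ^+ 3 + 4 * x ^+ 4.
    (* The minimum is about 0.57, near x = 7/10. *)
    have s1 : 0 <= (x - 7 / 10) ^+ 2 by exact: sqr_ge0.
    have s2 : 0 <= x * (x - 7 / 10) ^+ 2 by rewrite mulr_ge0 // ltW.
    have s3 : 0 <= x ^+ 2 * (x - 7 / 10) ^+ 2 by rewrite mulr_ge0// sqr_ge0.
    lra.
  nra.
split; nra.
Qed.

Lemma competitive_ratio_gt0 : alpha < 2 -> 0 < 8 + 4 / (2 - alpha) + 3 `^ alpha.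
Proof.
by move=> a2; rewrite ltr_wpDr ?powR_ge0// ltr_wpDr// divr_ge0// subr_ge0 ltW.
Qed.

(** The flows occur on both sides of their bounds. Being finite, they can be moved to the left with
    the factor [1 - beta = alpha^-1] remaining; multiplication by [alpha] then gives linear bounds.
    An infinite [M + Q + E] makes the claim trivial. *)
Lemma flow_combination (A1 A2 A3 M Q E : \bar R) : alpha < 2 ->
  (0 <= A1 -> 0 <= A2 -> 0 <= A3 -> 0 <= M -> 0 <= Q -> 0 <= E ->
   A1 + A2 + A3 < +oo ->
   A1 <= M + (alpha^-1%:E * E + beta%:E * A1) ->
   A2 <= Q + (alpha^-1%:E * E + beta%:E * A2) ->
   A3 <= Q + (alpha^-1%:E * E + beta%:E * (A3 + A2)) ->
   (1 + 2 * 3 `^ (alpha - 1))%:E * (A1 + A2 + A3) <=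
   (8 + 4 / (2 - alpha) + 3 `^ alpha)%:E * (M + Q + E))%E.
Proof.
move=> a2 A10 A20 A30 M0 Q0 E0 Afin F1 F2 F3.
case: (ltP (M + Q + E)%E +oo%E) => [ofin|]; last first.
  rewrite leye_eq => /eqP ->.
  by rewrite gt0_muley ?lte_fin ?competitive_ratio_gt0// leey.
have fin (X Y : \bar R) : (0 <= X)%E -> (0 <= Y)%E -> (X + Y < +oo)%E ->
    (X \is a fin_num) /\ (Y \is a fin_num).
  move=> X0 Y0 XY; rewrite !ge0_fin_numE//; split; apply: le_lt_trans XY.
    by rewrite leeDl.
  by rewrite leeDr.
have [A12f A3f] := fin _ _ (adde_ge0 A10 A20) A30 Afin.
have [A1f A2f] := fin _ _ A10 A20 (ltac:(by rewrite ltey_eq A12f)).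
have [MQf Ef] := fin _ _ (adde_ge0 M0 Q0) E0 ofin.
have [Mf Qf] := fin _ _ M0 Q0 (ltac:(by rewrite ltey_eq MQf)).
move: A10 A20 A30 M0 Q0 E0 F1 F2 F3.
rewrite -(fineK A1f) -(fineK A2f) -(fineK A3f) -(fineK Mf) -(fineK Qf) -(fineK Ef).
rewrite -?EFinM -?EFinD -?EFinM -?EFinD !lee_fin.
move: (fine A1) (fine A2) (fine A3) (fine M) (fine Q) (fine E) => x1 x2 x3 m q e.
move=> x10 x20 x30 m0 q0 e0 F1 F2 F3.
have aV : alpha * alpha^-1 = 1 by rewrite divff// gt_eqF.
have H1 : x1 <= alpha * m + e.
  by have := ler_wpM2l (ltW alpha_gt0) F1; nra.
have H2 : x2 <= alpha * q + e.
  by have := ler_wpM2l (ltW alpha_gt0) F2; nra.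
have H3 : x3 <= alpha * q + e + (alpha - 1) * x2.
  by have := ler_wpM2l (ltW alpha_gt0) F3; nra.
apply: (le_trans _ (competitive_constant a2 m0 q0 e0)).
rewrite ler_wpM2l ?addr_ge0 ?mulr_ge0 ?powR_ge0//.
have a1 : 0 <= alpha - 1 by rewrite subr_ge0 ltW.
by have := ler_wpM2l a1 H2; nra.
Qed.

End PowerInequalities.

Section NonnegIntegral.
Variable R : realType.
Local Notation mu := (@lebesgue_measure R).
Implicit Types f g : R -> R.

Lemma ge0_integralDr f g : (forall t, 0 <= f t) -> (forall t, 0 <= g t) ->
  measurable_fun setT f -> measurable_fun setT g ->
  (\int[mu]_(t in setT) (f t + g t)%:E =
   \int[mu]_(t in setT) (f t)%:E + \int[mu]_(t in setT) (g t)%:E)%E.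
Proof.
move=> f0 g0 mf mg; rewrite -ge0_integralD//.
- by move=> t _; rewrite lee_fin.
- exact/measurable_EFinP.
- by move=> t _; rewrite lee_fin.
- exact/measurable_EFinP.
Qed.

Lemma ge0_integralZr c f : 0 <= c -> (forall t, 0 <= f t) -> measurable_fun setT f ->
  (\int[mu]_(t in setT) (c * f t)%:E = c%:E * \int[mu]_(t in setT) (f t)%:E)%E.
Proof.
move=> c0 f0 mf; rewrite -ge0_integralZl_EFin//.
- by move=> t _; rewrite lee_fin.
- exact/measurable_EFinP.
Qed.

Lemma ge0_le_integralr f g : (forall t, 0 <= f t) ->
  measurable_fun setT f -> measurable_fun setT g -> (forall t, f t <= g t) ->
  (\int[mu]_(t in setT) (f t)%:E <= \int[mu]_(t in setT) (g t)%:E)%E.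
Proof.
move=> f0 mf mg fg; apply: ge0_le_integral => //.
- by move=> t _; rewrite lee_fin.
- exact/measurable_EFinP.
- exact/measurable_EFinP.
- by move=> t _; rewrite lee_fin.
Qed.

End NonnegIntegral.

(** * Weighted flow compared with an arbitrary schedule *)

Section FlowBound.
Variables (R : realType) (I : finType) (a b : I -> R -> R) (z rho : I -> R).
Local Notation mu := (@lebesgue_measure R).
Hypotheses (Ha : rate_family a z rho) (Hb : rate_family b z rho).
Variables (alpha c : R) (k S : R -> R).
Hypothesis alpha_gt1 : 1 < alpha.
Hypothesis c_ge0 : 0 <= c.
Hypothesis mk : measurable_fun setT k.
Hypothesis mS : measurable_fun setT S.
Hypothesis k_ge0 : forall t, 0 <= k t.
Hypothesis sum_le : forall t, \sum_i b i t <= S t.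
Let v t := Pinv alpha (c * k t + 1).
Hypothesis shortest_ex : forall t, 0 < k t -> exists i, shortest a z rho k v i t.

Let No t : R := \sum_i (pending z rho b i t)%:R.
Let Na t : R := \sum_i (pending z rho a i t)%:R.
Let h (x : R) : R := (Num.max (c * x) 0) `^ (1 - alpha^-1).

(** The weight [c] of an item is 1 for tasks and [r] for jobs. Pointwise,
    [c * (k - No) <= v * h (k - No)]; [srpt_potential] replaces the right side by the speed of the
    other schedule times [h (Na)], and Young's inequality splits this product into energy and a
    fraction of the flow. *)
Lemma flow_bound :
  (\int[mu]_(t in setT) (c * k t)%:E <= \int[mu]_(t in setT) (c * No t)%:E +
   (alpha^-1%:E * \int[mu]_(t in setT) (S t `^ alpha)%:E +
    (1 - alpha^-1)%:E * \int[mu]_(t in setT) (c * Na t)%:E))%E.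
Proof.
have b0 := conj_exponent_gt0 alpha_gt1.
have a0 : 0 < alpha by exact: lt_trans alpha_gt1.
have hmono : {homo h : x y / x <= y}.
  move=> x y xy; apply: ge0_ler_powR; rewrite ?(ltW b0) ?nnegrE//.
  - by rewrite le_max lexx orbT.
  - by rewrite le_max lexx orbT.
  - by rewrite ge_max !le_max lexx orbT ler_wpM2l.
have h0 x : x <= 0 -> h x = 0.
  by move=> x0; rewrite /h max_r ?powR0 ?gt_eqF// mulr_ge0_le0.
have h_ge0 x : 0 <= h x by exact: powR_ge0.
have mh : measurable_fun setT h by exact: nondecreasing_measurable.
have mNo : measurable_fun setT No := measurable_pending Hb.
have mNa : measurable_fun setT Na := measurable_pending Ha.
have mv : measurable_fun setT v.
  apply: measurableT_comp; first exact: measurable_powR.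
  by apply: measurable_funD => //; apply: measurable_funM.
have v0 t : 0 <= v t by exact: powR_ge0.
have No0 t : 0 <= No t by rewrite sumr_ge0.
have Na0 t : 0 <= Na t by rewrite sumr_ge0.
have mhN : measurable_fun setT (fun t => h (k t - No t)).
  by apply: measurableT_comp => //; exact: measurable_funB.
have mhNa : measurable_fun setT (fun t => h (Na t)) by exact: measurableT_comp.
have mSb : measurable_fun setT (fun t => \sum_i b i t).
  by apply: measurable_sum => i; case: Hb => + _ _ _; exact.
have Sb0 t : 0 <= \sum_i b i t by apply: sumr_ge0 => i _; case: Hb => _ + _ _; exact.
have mSa : measurable_fun setT (fun t => S t `^ alpha).
  exact: (measurableT_comp (measurable_powR alpha) mS).
have P := srpt_potential Ha Hb mk mv v0 hmono h0 shortest_ex.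
have mM (f : R -> R) : measurable_fun setT f -> measurable_fun setT (fun t => c * f t).
  by move=> mf; exact: measurable_funM.
have cNa0 t : 0 <= c * Na t by rewrite mulr_ge0.
apply: (@le_trans _ _ (\int[mu]_(t in setT) (c * No t + v t * h (k t - No t))%:E)%E).
  apply: ge0_le_integralr.
  - by move=> t; rewrite mulr_ge0.
  - exact: mM.
  - by apply: measurable_funD; [exact: mM|exact: measurable_funM].
  - move=> t; rewrite -lerBlDl -mulrBr; apply: le_mul_powR_conj => //.
    by rewrite mulrBr; have := mulr_ge0 c_ge0 (No0 t); lra.
rewrite ge0_integralDr; last 4 first.
- by move=> t; rewrite mulr_ge0.
- by move=> t; rewrite mulr_ge0.
- exact: mM.
- exact: measurable_funM.
rewrite leeD2l//; apply: (le_trans P).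
have ai0 : 0 <= alpha^-1 by rewrite invr_ge0 ltW.
have pS t : 0 <= S t `^ alpha by exact: powR_ge0.
have mcNa := mM _ mNa.
rewrite -(ge0_integralZr ai0 pS mSa) -(ge0_integralZr (ltW b0) cNa0 mcNa).
rewrite -ge0_integralDr; last 4 first.
- by move=> t; rewrite mulr_ge0// powR_ge0.
- by move=> t; rewrite mulr_ge0// ltW.
- exact: measurable_funM.
- by apply: measurable_funM => //; exact: mM.
apply: ge0_le_integralr.
- by move=> t; rewrite mulr_ge0.
- exact: measurable_funM.
- apply: measurable_funD; first exact: measurable_funM.
  by apply: measurable_funM => //; exact: mM.
- move=> t; apply: (@le_trans _ _ (S t * h (Na t))); first by rewrite ler_wpM2r.
  rewrite /h max_l//; apply: young_powR => //.
  exact: le_trans (Sb0 t) (sum_le t).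
Qed.

End FlowBound.

(** * Schedules and the algorithm *)

Section Schedules.
Variables (R : realType) (T J : finType) (job : T -> J) (ismap : T -> bool)
  (size : T -> R) (rel : J -> R).
Local Notation mu := (@lebesgue_measure R).
Local Notation feas := (feasible job ismap size rel).

(* Tasks outside [P] keep their index but get rate and size 0, so they are never pending. *)
Definition restr (P : pred T) (s : schedule R T) (x : T) (t : R) : R :=
  (P x)%:R * s x t.
Definition restr_size (P : pred T) (x : T) : R := (P x)%:R * size x.

Lemma restr_in (P : pred T) s x : P x -> restr P s x = s x.
Proof. by move=> Px; apply/funext => t; rewrite /restr Px mul1r. Qed.

Lemma restr_family P s : feas s -> rate_family (restr P s) (restr_size P) (rel \o job).
Proof.
move=> [ms s0 srel sint _]; split => x.
- by apply: measurable_funM.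
- by move=> t; rewrite mulr_ge0.
- by move=> t tr; rewrite /restr srel// mulr0.
- by rewrite ge0_integralZr// sint.
Qed.

Lemma work_le s x t : feas s -> work s x t <= size x.
Proof. by case=> ms s0 srel sint _; exact: (served_le (ms x) (s0 x) (sint x)). Qed.

Lemma work_mono s x : feas s -> {homo work s x : t u / t <= u}.
Proof. by case=> ms s0 srel sint _; exact: (served_mono (ms x) (s0 x) (sint x)). Qed.

Lemma pending_restr P s x t : feas s ->
  pending (restr_size P) (rel \o job) (restr P s) x t = P x && unfinished job size rel s x t.
Proof.
move=> fs; rewrite /pending /unfinished /restr_size.
case: (boolP (P x)) => [Px|nPx]; first by rewrite restr_in// mul1r.
rewrite mul0r; apply/negbTE; rewrite negb_and -leNgt; apply/orP; right.
have [m c0 crel cint] := restr_family P fs.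
exact: (served_ge0 (m x) (c0 x) (cint x)).
Qed.

Lemma sum_natb_card (I : finType) (p : pred I) :
  \sum_i (p i)%:R = #|[set i | p i]|%:R :> R.
Proof.
rewrite cardsE -sum1_card natr_sum [RHS]big_mkcond /=; apply: eq_bigr => i _.
by rewrite unfold_in; case: (p i).
Qed.

Lemma sum_pending_restr P s t : feas s ->
  \sum_x (pending (restr_size P) (rel \o job) (restr P s) x t)%:R =
  #|[set x | P x && unfinished job size rel s x t]|%:R :> R.
Proof.
by move=> fs; rewrite -sum_natb_card; apply: eq_bigr => x _; rewrite pending_restr.
Qed.

Definition map_of (j : J) : pred T := fun x => ismap x && (job x == j).
(** A job is treated as a single item made of its map tasks, so that (M2) becomes a
    shortest-remaining-first rule among jobs. *)
Definition job_rate (s : schedule R T) (j : J) (t : R) : R :=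
  \sum_x restr (map_of j) s x t.
Definition job_size (j : J) : R := \sum_x restr_size (map_of j) x.

Lemma job_family s : feas s -> rate_family (job_rate s) job_size rel.
Proof.
move=> fs.
have [ms s0 srel sint _] := fs.
have F j := restr_family (map_of j) fs.
split => j.
- by apply: measurable_sum => x; case: (F j).
- by move=> t; apply: sumr_ge0 => x _; case: (F j).
- move=> t tj; apply: big1 => x _; rewrite /restr /map_of.
  by case: andP => [[_ /eqP xj]|_]; rewrite ?mul0r// srel ?mulr0// xj.
- rewrite ge0_integral_sumr//; [|by case: (F j)..].
  by rewrite -sumEFin; apply: eq_bigr => x _; case: (F j).
Qed.

Lemma served_job_rate s j t : feas s ->
  served (job_rate s j) t = \sum_x (map_of j x)%:R * work s x t.
Proof.
move=> fs; apply: EFin_inj.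
have mD : measurable ([set u | u <= t]%classic : set (measurableTypeR R)).
  have -> : [set u | u <= t]%classic = `]-oo, t]%classic.
    by apply/seteqP; split => u; rewrite /= in_itv.
  exact: measurable_itv.
have [m c0 crel cint] := job_family fs.
have [m' c0' crel' cint'] := restr_family (map_of j) fs.
rewrite (EFin_served (m j) (c0 j) (cint j)) /job_rate (ge0_integral_sumr mD)//.
rewrite -sumEFin; apply: eq_bigr => x _.
rewrite -(EFin_served (m' x) (c0' x) (cint' x)); congr EFin.
case: (boolP (map_of j x)) => [Px|nPx]; first by rewrite restr_in// mul1r.
rewrite mul0r; apply/eqP; rewrite eq_le (served_ge0 (m' x) (c0' x) (cint' x)) andbT.
have := served_le (m' x) (c0' x) (cint' x) t.
by rewrite /restr_size (negbTE nPx) mul0r.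
Qed.

(** [cum] omits finished tasks, which have no work left. Before the release it would omit every
    task, hence [rel j <= t]. *)
Lemma remaining_job_rate s j t : feas s -> rel j <= t ->
  job_size j - served (job_rate s j) t = cum job ismap size rel s j t.
Proof.
move=> fs jt; rewrite served_job_rate// /job_size -sumrB /cum [RHS]big_mkcond /=.
apply: eq_bigr => x _; rewrite /restr_size -mulrBr /mapU inE /map_of /unfinished /Defs.rem.
case: (ismap x) => /=; last by rewrite mul0r.
case: eqP => [xj|_]; last by rewrite andbF mul0r.
rewrite xj jt /= andbT mul1r; case: ltP => // h.
by apply/eqP; rewrite subr_eq0 eq_le h work_le.
Qed.

Lemma cum_gt0 s j t : feas s -> (0 < cum job ismap size rel s j t) =
  [exists x, (x \in mapU job ismap size rel s t) && (job x == j)].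
Proof.
move=> fs.
have rem_gt0 x : x \in mapU job ismap size rel s t -> 0 < Defs.rem size s x t.
  by rewrite inE => /and3P[_ _]; rewrite /Defs.rem subr_gt0.
apply/idP/existsP => [|[x /andP[xm xj]]].
  apply: contraPP => /forallNP H; rewrite /cum big_pred0 ?ltxx// => x.
  exact/negP/H.
rewrite /cum (bigD1 x) /=; last by rewrite xm xj.
rewrite ltr_wpDr ?rem_gt0//; apply: sumr_ge0 => y /andP[/andP[ym _] _].
exact/ltW/rem_gt0.
Qed.

Lemma pending_job_rate s j t : feas s ->
  pending job_size rel (job_rate s) j t =
  [exists x, (x \in mapU job ismap size rel s t) && (job x == j)].
Proof.
move=> fs; rewrite /pending; case: (leP (rel j) t) => [jt|tj] /=.
  by rewrite -subr_gt0 remaining_job_rate// cum_gt0.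
apply/esym/negbTE; apply/existsP => -[x /andP[]]; rewrite inE /unfinished.
by move=> /and3P[_ xt _] /eqP xj; move: tj; rewrite -xj ltNge xt.
Qed.

Lemma sum_pending_job_rate s t : feas s ->
  \sum_j (pending job_size rel (job_rate s) j t)%:R =
  (Jcount job ismap size rel s t)%:R :> R.
Proof.
by move=> fs; rewrite -sum_natb_card; apply: eq_bigr => x _; rewrite pending_job_rate.
Qed.

End Schedules.

(** * Competitive analysis of the algorithm *)

Section Algorithm.
Variables (R : realType) (alpha : R) (T J : finType) (job : T -> J)
  (ismap : T -> bool) (size : T -> R) (rel : J -> R) (r : nat).
Hypothesis alpha_gt1 : 1 < alpha.
Hypothesis size_gt0 : forall x, 0 < size x.
Hypothesis r_gt0 : (0 < r)%N.
Hypothesis reduces_card : forall j, #|[set x | (job x == j) && ~~ ismap x]| = r.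
Local Notation mu := (@lebesgue_measure R).
Local Notation feas := (feasible job ismap size rel).
Local Notation mapU := (mapU job ismap size rel).
Local Notation freeR := (freeR job ismap size rel).
Local Notation Jcount := (Jcount job ismap size rel).

Definition reduceU (s : schedule R T) (t : R) : {set T} :=
  [set x | ~~ ismap x && unfinished job size rel s x t].

Definition speed (s : schedule R T) (t : R) : R := \sum_x s x t.

Let measurable_unfinished s x : feas s -> measurable_fun setT (unfinished job size rel s x).
Proof.
case=> ms s0 srel sint _; apply: measurable_and; first exact: measurable_fun_ler.
by apply: measurable_fun_ltr => //; exact: (measurable_served (ms x) (s0 x) (sint x)).
Qed.

Lemma measurable_mapU s : feas s -> measurable_fun setT (fun t => #|mapU s t|%:R : R).
Proof.
move=> fs; under eq_fun do rewrite -sum_natb_card; apply: measurable_sum_natb => x.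
by apply: measurable_and => //; exact: measurable_unfinished.
Qed.

Lemma measurable_reduceU s : feas s -> measurable_fun setT (fun t => #|reduceU s t|%:R : R).
Proof.
move=> fs; under eq_fun do rewrite -sum_natb_card; apply: measurable_sum_natb => x.
by apply: measurable_and => //; exact: measurable_unfinished.
Qed.

Lemma measurable_freeR s : feas s -> measurable_fun setT (fun t => #|freeR s t|%:R : R).
Proof.
move=> fs; under eq_fun do rewrite -sum_natb_card; apply: measurable_sum_natb => x.
apply: measurable_and; first by apply: measurable_and => //; exact: measurable_unfinished.
apply: measurable_forall => y.
case: (ismap y && _) => /=; last exact: measurable_cst.
case: fs => ms s0 srel sint _; apply: measurable_fun_ler => //.
exact: (measurable_served (ms y) (s0 y) (sint y)).
Qed.

Lemma measurable_Jcount s : feas s -> measurable_fun setT (fun t => (Jcount s t)%:R : R).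
Proof.
move=> fs; under eq_fun do rewrite -sum_pending_job_rate//.
exact: (measurable_pending (job_family fs)).
Qed.

Lemma measurable_speed s : feas s -> measurable_fun setT (speed s).
Proof. by case=> ms _ _ _ _; exact: measurable_sum. Qed.

Lemma n_unfinished_split s t :
  n_unfinished job size rel s t = (#|mapU s t| + #|reduceU s t|)%N.
Proof.
rewrite /n_unfinished -(cardsID [set x | ismap x]); congr addn; apply: eq_card => x.
  by rewrite !inE andbC.
by rewrite !inE andbC.
Qed.

Let map_jobs s t : {set J} :=
  [set j | [exists x, (x \in mapU s t) && (job x == j)]].

Lemma card_reduces_in (A : {set J}) :
  #|[set x | ~~ ismap x && (job x \in A)]| = (r * #|A|)%N.
Proof.
rewrite -sum1_card (partition_big job (mem A)) /=; last by move=> x; rewrite inE => /andP[].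
rewrite (eq_bigr (fun=> r)); first by rewrite sum_nat_const mulnC.
move=> j jA; rewrite -(reduces_card j) -[RHS]sum1_card; apply: eq_bigl => x.
by rewrite !inE; case: eqP => [->|]; rewrite ?jA ?andbT ?andbF.
Qed.

(** While a map task of a job is unfinished, all [r] reduce tasks of the job are untouched, hence
    unfinished since sizes are positive. Applied to the other schedule, this compares its weighted
    job count with its reduce tasks. *)
Lemma Jcount_le_reduceU s t : feas s -> (r * Jcount s t <= #|reduceU s t|)%N.
Proof.
move=> fs; have [ms s0 srel sint sprec] := fs.
rewrite -(card_reduces_in (map_jobs s t)); apply: subset_leq_card.
apply/fintype.subsetP => x; rewrite !inE => /andP[rx /existsP[y]].
rewrite !inE => /andP[/and3P[my ry wy] /eqP yx]; rewrite rx /unfinished -yx ry /=.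
suff -> : work s x t = 0 by exact: size_gt0.
rewrite /work /Rintegral integral0_eq// => u /= ut; congr EFin.
(* A nonzero rate at [u <= t] would force the map task [y] to be complete at [u], hence at [t]. *)
apply/eqP; apply: contraTT wy => sx; have h := sprec x u rx sx y my yx.
by rewrite -leNgt (le_trans h)// (work_mono _ fs).
Qed.

(** An unfinished reduce task that is not free belongs to a job with an unfinished map task, and
    each such job has [r] reduce tasks. *)
Lemma reduceU_le s t : feas s ->
  (#|reduceU s t| <= #|freeR s t| + r * Jcount s t)%N.
Proof.
move=> fs; rewrite -(card_reduces_in (map_jobs s t)).
apply: leq_trans (leq_card_setU _ _); apply: subset_leq_card.
apply/fintype.subsetP => x; rewrite !inE => /andP[rx /[dup] ux ->]; rewrite rx /=.
case: (boolP [forall y, _]) => //= /forallPn[y].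
rewrite negb_imply -ltNge => /andP[/andP[my /eqP yx] wy].
apply/existsP; exists y; rewrite !inE my /unfinished yx eqxx wy andbT /=.
by case/andP: ux => ->.
Qed.

Variable s : schedule R T.
Hypothesis alg : alg_schedule job ismap size rel alpha r s.
Let fs : feas s. Proof. by case: alg. Qed.
Let s_ge0 x t : 0 <= s x t. Proof. by case: fs. Qed.

Let sum_option (o : option T) (c : R) :
  \sum_x (o == Some x)%:R * c = (o != None)%:R * c.
Proof.
case: o => [y|]; last by rewrite [RHS]mul0r; apply: big1 => x _; rewrite mul0r.
rewrite (bigD1 y)//= eqxx big1 ?addr0//= => x xy.
by rewrite (_ : (Some y == Some x) = false) ?mul0r//; apply/negbTE; rewrite eq_sym.
Qed.

Lemma speedE t : speed s t =
  (mapU s t != finset.set0)%:R * Pinv alpha (#|mapU s t|.+1)%:R +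
  (mapU s t != finset.set0)%:R * Pinv alpha ((r * Jcount s t).+1)%:R +
  (freeR s t != finset.set0)%:R * Pinv alpha (#|freeR s t|.+1)%:R.
Proof.
case: alg => _ /(_ t) [u1 [u2 [u3 [[e1 e2 e3] _ _ _ e]]]].
rewrite /speed (eq_bigr _ (fun x _ => e x)).
by rewrite !big_split /= !sum_option e1 e2 e3.
Qed.

Let Pinv_ge1 n : 1 <= Pinv alpha n.+1%:R.
Proof.
rewrite -[leLHS](powRr0 n.+1%:R) ler_powR ?ler1n// invr_ge0.
by rewrite ltW// (lt_trans _ alpha_gt1).
Qed.

Let Pinv_ge0 n : 0 <= Pinv alpha n.+1%:R.
Proof. exact: le_trans ler01 (Pinv_ge1 n). Qed.

Let powR_Pinv (b : bool) (n : nat) : (b%:R * Pinv alpha n.+1%:R) `^ alpha = b%:R * n.+1%:R.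
Proof.
have a0 : 0 < alpha by exact: lt_trans alpha_gt1.
case: b; rewrite ?mul0r ?powR0 ?gt_eqF// !mul1r /Pinv -powRrM mulVf ?gt_eqF//.
by rewrite powRr1.
Qed.

Lemma Jcount_gt0 t : mapU s t != finset.set0 -> (0 < Jcount s t)%N.
Proof.
case/set0Pn => x xm; rewrite card_gt0; apply/set0Pn; exists (job x).
by rewrite inE; apply/existsP; exists x; rewrite xm eqxx.
Qed.

Definition load t : nat := (#|mapU s t| + r * Jcount s t + #|freeR s t|)%N.

(** An active rule with count [n >= 1] would alone use power [n + 1 <= 2 * n]; the factor
    [3^(alpha - 1)] is the convexity loss from adding three rates. *)
Lemma power_le_load t :
  speed s t `^ alpha <= 2 * 3 `^ (alpha - 1) * (load t)%:R.
Proof.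
rewrite speedE (le_trans (powR_sum3_le _ _ _ _))// ?mulr_ge0//.
rewrite !powR_Pinv [2 * _]mulrC -mulrA ler_wpM2l ?powR_ge0// -natrM.
rewrite -!natrM -!natrD ler_nat /load !mulnDr !leq_add//.
- by rewrite -card_gt0; case: ltnP => /=; lia.
- case: (eqVneq (mapU s t)) => //= /Jcount_gt0 j0.
  by have : (0 < r * Jcount s t)%N; [rewrite muln_gt0 r_gt0|lia].
- by rewrite -card_gt0; case: ltnP => /=; lia.
Qed.

Lemma speed_ge1 t : (0 < load t)%N -> 1 <= speed s t.
Proof.
rewrite speedE => l0.
case: (eqVneq (mapU s t) finset.set0) => [m0|mn] /=; last first.
  rewrite -addrA !mul1r ler_wpDr// addr_ge0// mulr_ge0//.
case: (eqVneq (freeR s t) finset.set0) => [f0|fn] /=.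
  move: l0; rewrite /load m0 f0 !cards0 addn0 add0n (_ : Jcount s t = 0%N) ?muln0//.
  apply/eqP; rewrite cards_eq0; apply/eqP/setP => j; rewrite !inE.
  by apply/existsP => -[x]; rewrite m0 inE.
by rewrite !mul0r !add0r mul1r.
Qed.

Let shortest_restr (P : pred T) (A : {set T}) (v : R -> R) (k : R -> R) x t :
  P x -> unfinished job size rel s x t -> v t <= s x t ->
  {in A, forall y, [&& P y, unfinished job size rel s y t &
    Defs.rem size s x t <= Defs.rem size s y t]} ->
  k t = #|A|%:R ->
  shortest (restr P s) (restr_size size P) (rel \o job) k v x t.
Proof.
move=> Px /andP[xt wx] vx HA kA; rewrite /shortest restr_in// /restr_size Px mul1r.
apply/and4P; split => //.
rewrite kA sum_natb_card ler_nat subset_leq_card//; apply/fintype.subsetP => y /HA.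
by rewrite inE => /and3P[Py /andP[yt _] xy]; rewrite restr_in// Py mul1r yt.
Qed.

Let sum_restr_le P o t : feas o -> \sum_x restr P o x t <= speed o t.
Proof.
case=> _ o0 _ _ _; apply: ler_sum => x _; rewrite /restr.
by case: (P x); rewrite ?mul1r// mul0r.
Qed.

Variable o : schedule R T.
Hypothesis fo : feas o.

Local Notation Int f := (\int[mu]_(t in setT) (f t)%:E)%E.

Lemma flow_maps :
  (Int (fun t => #|mapU s t|%:R : R) <= Int (fun t => #|mapU o t|%:R : R) +
   (alpha^-1%:E * Int (fun t => speed o t `^ alpha) +
    (1 - alpha^-1)%:E * Int (fun t => #|mapU s t|%:R : R)))%E.
Proof.
suff sh t : (0 : R) < #|mapU s t|%:R ->
    exists i, shortest (restr ismap s) (restr_size size ismap) (rel \o job)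
    (fun t => #|mapU s t|%:R) (fun t => Pinv alpha (1 * #|mapU s t|%:R + 1)) i t.
  have := flow_bound (restr_family ismap fs) (restr_family ismap fo) alpha_gt1 ler01
    (measurable_mapU fs) (measurable_speed fo) (fun t => ler0n R _)
    (fun t => sum_restr_le ismap t fo) sh.
  under eq_integral do rewrite mul1r.
  under [X in (_ <= X + _)%E]eq_integral do rewrite mul1r (sum_pending_restr _ _ fo).
  under [X in (_ <= _ + (_ + _ * X))%E]eq_integral do rewrite mul1r (sum_pending_restr _ _ fs).
  by [].
rewrite ltr0n card_gt0 => m0.
case: alg => _ /(_ t) [u1 [u2 [u3 [[e1 e2 e3] h1 _ _ e]]]].
case: u1 e1 h1 e => [x|]; last by rewrite eqxx => /esym/eqP m0'; rewrite m0' eqxx in m0.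
move=> _ /(_ _ erefl)[xm xmin] e; exists x.
have := xm; rewrite inE => /andP[mx ux].
apply: (@shortest_restr ismap (mapU s t)) => //.
  rewrite mul1r natr1 e eqxx mul1r -addrA lerDl addr_ge0// mulr_ge0//.
by move=> y ym; have := ym; rewrite inE => /andP[-> ->]; rewrite xmin.
Qed.

(** The items are all reduce tasks, since the two schedules may free them at different times; only
    [k] is restricted to free ones. The last term therefore includes blocked reduce tasks, which
    brings [A2] into the bound on [A3]. *)
Lemma flow_reduces :
  (Int (fun t => #|freeR s t|%:R : R) <= Int (fun t => #|reduceU o t|%:R : R) +
   (alpha^-1%:E * Int (fun t => speed o t `^ alpha) +
    (1 - alpha^-1)%:E * Int (fun t => #|reduceU s t|%:R : R)))%E.
Proof.
pose P : pred T := fun x => ~~ ismap x.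
suff sh t : (0 : R) < #|freeR s t|%:R ->
    exists i, shortest (restr P s) (restr_size size P) (rel \o job)
    (fun t => #|freeR s t|%:R) (fun t => Pinv alpha (1 * #|freeR s t|%:R + 1)) i t.
  have := flow_bound (restr_family P fs) (restr_family P fo) alpha_gt1 ler01
    (measurable_freeR fs) (measurable_speed fo) (fun t => ler0n R _)
    (fun t => sum_restr_le P t fo) sh.
  under eq_integral do rewrite mul1r.
  under [X in (_ <= X + _)%E]eq_integral do rewrite mul1r (sum_pending_restr _ _ fo).
  under [X in (_ <= _ + (_ + _ * X))%E]eq_integral do rewrite mul1r (sum_pending_restr _ _ fs).
  by [].
rewrite ltr0n card_gt0 => m0.
case: alg => _ /(_ t) [u1 [u2 [u3 [[e1 e2 e3] _ _ h3 e]]]].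
case: u3 e3 h3 e => [x|]; last by rewrite eqxx => /esym/eqP m0'; rewrite m0' eqxx in m0.
move=> _ /(_ _ erefl)[xm xmin] e; exists x.
have := xm; rewrite inE => /andP[/andP[mx ux] _].
apply: (@shortest_restr P (freeR s t)) => //.
  rewrite mul1r natr1 e eqxx mul1r lerDr addr_ge0// mulr_ge0//.
by move=> y ym; have := ym; rewrite inE => /andP[/andP[ny ->] _]; rewrite xmin// /P ny.
Qed.

Lemma flow_jobs :
  (Int (fun t => (r * Jcount s t)%:R : R) <= Int (fun t => (r * Jcount o t)%:R : R) +
   (alpha^-1%:E * Int (fun t => speed o t `^ alpha) +
    (1 - alpha^-1)%:E * Int (fun t => (r * Jcount s t)%:R : R)))%E.
Proof.
have sum_le t : \sum_j job_rate job ismap o j t <= speed o t.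
  rewrite /job_rate exchange_big /=; apply: ler_sum => x _.
  have o0 : 0 <= o x t by case: fo.
  rewrite (bigD1 (job x))//= big1 ?addr0.
    by rewrite /restr; case: (map_of _ _ _ _); rewrite ?mul1r// mul0r.
  by move=> j jx; rewrite /restr /map_of eq_sym (negbTE jx) andbF mul0r.
suff sh t : (0 : R) < (Jcount s t)%:R ->
    exists i, shortest (job_rate job ismap s) (job_size job ismap size) (rel)
    (fun t => (Jcount s t)%:R) (fun t => Pinv alpha (r%:R * (Jcount s t)%:R + 1)) i t.
  have := flow_bound (job_family fs) (job_family fo) alpha_gt1 (ler0n R r)
    (measurable_Jcount fs) (measurable_speed fo) (fun t => ler0n R _) sum_le sh.
  under eq_integral do rewrite -natrM.
  under [X in (_ <= X + _)%E]eq_integral do rewrite (sum_pending_job_rate _ fo) -natrM.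
  under [X in (_ <= _ + (_ + _ * X))%E]eq_integral do rewrite (sum_pending_job_rate _ fs) -natrM.
  by [].
rewrite ltr0n card_gt0 => /set0Pn[j0]; rewrite inE => /existsP[x0 /andP[x0m _]].
case: alg => _ /(_ t) [u1 [u2 [u3 [[e1 e2 e3] _ h2 _ e]]]].
case: u2 e2 h2 e => [x|]; last by rewrite eqxx => /esym/eqP m0; rewrite m0 inE in x0m.
move=> _ /(_ _ erefl)[xm xcum _] e; exists (job x).
have xj : [exists y, (y \in mapU s t) && (job y == job x)].
  by apply/existsP; exists x; rewrite xm eqxx.
have := xj; rewrite -pending_job_rate// => /andP[xt wx].
have := xm; rewrite inE => /andP[mx _].
apply/and4P; split => //.
  (* The task chosen by (M2) alone already gives its job the required rate. *)
  rewrite -natrM natr1 /job_rate (bigD1 x)//= ler_wpDr//.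
    by apply: sumr_ge0 => y _; rewrite mulr_ge0.
  rewrite /restr /map_of mx eqxx mul1r e eqxx mul1r addrAC lerDr addr_ge0// mulr_ge0//.
rewrite sum_natb_card ler_nat subset_leq_card//; apply/fintype.subsetP => j.
rewrite inE => Ej; have := Ej; rewrite -pending_job_rate// => /andP[jt _].
rewrite inE jt (remaining_job_rate fs xt) (remaining_job_rate fs jt).
case/existsP: Ej => y /andP[ym /eqP <-].
by rewrite xcum.
Qed.

(** Finiteness is what allows [flow_combination] to absorb the flow terms. The load is at most [C],
    and the speed is at least 1 while the load is positive, so the integral is at most [C] times the
    total work. *)
Lemma integral_load_lty : (Int (fun t => (load t)%:R : R) < +oo)%E.
Proof.
have ms := measurable_speed fs.
pose C : R := (#|T| + r * #|J| + #|T|)%:R.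
have sp0 t : 0 <= speed s t by exact: sumr_ge0.
have mload : measurable_fun setT (fun t => (load t)%:R : R).
  under eq_fun do rewrite /load !natrD natrM.
  apply: measurable_funD; last exact: measurable_freeR.
  apply: measurable_funD; first exact: measurable_mapU.
  by apply: measurable_funM => //; exact: measurable_Jcount.
apply: (@le_lt_trans _ _ (Int (fun t => C * speed s t))).
  apply: ge0_le_integralr => //; first exact: measurable_funM.
  move=> t; case: (posnP (load t)) => [->|l0]; first by rewrite mulr_ge0.
  apply: (@le_trans _ _ C); last by rewrite ler_peMr// speed_ge1.
  by rewrite ler_nat /load !leq_add ?leq_mul ?max_card.
rewrite ge0_integralZr//; have [ms' s0 _ sint _] := fs.
by rewrite ge0_integral_sumr// (eq_bigr _ (fun x _ => sint x)) sumEFin -EFinM ltry.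
Qed.

Lemma cost_le : alpha < 2 ->
  (cost job size rel alpha s <=
   (8 + 4 / (2 - alpha) + 3 `^ alpha)%:E * cost job size rel alpha o)%E.
Proof.
move=> a2.
have a0 : 0 < alpha by exact: lt_trans alpha_gt1.
have msd := measurable_speed.
have mE u : feas u -> measurable_fun setT (fun t => speed u t `^ alpha).
  by move=> fu; exact: (measurableT_comp (measurable_powR alpha) (msd _ fu)).
have mn (n : R -> nat) : (0 <= Int (fun t => (n t)%:R : R))%E.
  by apply: integral_ge0 => t _; rewrite lee_fin.
have mJ u : feas u -> measurable_fun setT (fun t => (r * Jcount u t)%:R : R).
  move=> fu; under eq_fun do rewrite natrM.
  by apply: measurable_funM => //; exact: measurable_Jcount.
have p0 u t : 0 <= speed u t `^ alpha by exact: powR_ge0.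
set A1 := Int (fun t => #|mapU s t|%:R : R).
set A2 := Int (fun t => (r * Jcount s t)%:R : R).
set A3 := Int (fun t => #|freeR s t|%:R : R).
set M := Int (fun t => #|mapU o t|%:R : R).
set Q := Int (fun t => #|reduceU o t|%:R : R).
set E := Int (fun t => speed o t `^ alpha).
have E0 : (0 <= E)%E by apply: integral_ge0 => t _; rewrite lee_fin.
have n0 (f : R -> nat) t : (0 : R) <= (f t)%:R by [].
have m1 := measurable_mapU fs.
have m2 := mJ _ fs.
have m3 := measurable_freeR fs.
have m12 := measurable_funD m1 m2.
have n12 t : (0 : R) <= #|mapU s t|%:R + (r * Jcount s t)%:R by rewrite addr_ge0.
have loadE : Int (fun t => (load t)%:R : R) = (A1 + A2 + A3)%E.
  under eq_integral do rewrite /load !natrD.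
  by rewrite (ge0_integralDr n12 (n0 _) m12 m3) (ge0_integralDr (n0 _) (n0 _) m1 m2).
have mload : measurable_fun setT (fun t => (load t)%:R : R).
  under eq_fun do rewrite /load !natrD.
  apply: measurable_funD; last exact: measurable_freeR.
  by apply: measurable_funD; [exact: m1|exact: m2].
have costo : cost job size rel alpha o = (M + Q + E)%E.
  rewrite /cost; congr (_ + _)%E.
  under eq_integral do rewrite n_unfinished_split natrD.
  exact: (ge0_integralDr (n0 _) (n0 _) (measurable_mapU fo) (measurable_reduceU fo)).
(* The summand 1 covers the flow time, by [reduceU_le]; the other one covers the energy, by
   [power_le_load]. *)
have costs : (cost job size rel alpha s <= (1 + 2 * 3 `^ (alpha - 1))%:E * (A1 + A2 + A3))%E.
  have y0 : 0 <= 2 * 3 `^ (alpha - 1) by rewrite mulr_ge0 ?powR_ge0.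
  rewrite EFinD ge0_muleDl ?lee_fin// mul1e -loadE -(ge0_integralZr y0)//.
  apply: leeD.
    apply: ge0_le_integralr => //.
      under eq_fun do rewrite n_unfinished_split natrD.
      by apply: measurable_funD; [exact: measurable_mapU|exact: measurable_reduceU].
    move=> t; rewrite ler_nat n_unfinished_split /load -addnA leq_add2l addnC.
    exact: reduceU_le.
  apply: ge0_le_integralr; [exact: (p0 s)|exact: (mE _ fs)|exact: measurable_funM|].
  exact: power_le_load.
have F1 := flow_maps; have F2 := flow_jobs; have F3 := flow_reduces.
have G2 : (Int (fun t => (r * Jcount o t)%:R : R) <= Q)%E.
  apply: ge0_le_integralr => //; [exact: (mJ _ fo)|exact: measurable_reduceU|].
  by move=> t; rewrite ler_nat Jcount_le_reduceU.
have G3 : (Int (fun t => #|reduceU s t|%:R : R) <= A3 + A2)%E.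
  rewrite -(ge0_integralDr (n0 _) (n0 _) m3 m2).
  apply: ge0_le_integralr => //; first exact: measurable_reduceU.
    exact: measurable_funD m3 m2.
  by move=> t; rewrite -natrD ler_nat reduceU_le.
have := integral_load_lty; rewrite loadE costo => Afin.
have A10 : (0 <= A1)%E by exact: mn.
have A20 : (0 <= A2)%E by exact: mn.
have A30 : (0 <= A3)%E by exact: mn.
have M0 : (0 <= M)%E by exact: mn.
have Q0 : (0 <= Q)%E by exact: mn.
have b0 : (0 <= (1 - alpha^-1)%:E)%E by rewrite lee_fin ltW// conj_exponent_gt0.
apply: (le_trans costs); apply: flow_combination => //.
  exact: le_trans F2 (leeD2r _ G2).
exact: le_trans F3 (leeD2l _ (leeD2l _ (lee_wpmul2l b0 G3))).
Qed.

End Algorithm.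

Theorem theorem3 (R : realType) (alpha : R) (T J : finType) (job : T -> J)
    (ismap : T -> bool) (size : T -> R) (rel : J -> R) (r : nat) :
  1 < alpha -> alpha < 2 ->
  (forall x, 0 < size x) ->
  (0 < r)%N ->
  (forall j, #|[set x | (job x == j) && ~~ ismap x]| = r) ->
  (forall j, 0 < #|[set x | (job x == j) && ismap x]|)%N ->
  forall s : schedule R T,
    alg_schedule job ismap size rel alpha r s ->
    (cost job size rel alpha s
      <= (8 + 4 / (2 - alpha) + 3 `^ alpha)%:E * opt_cost job ismap size rel alpha)%E.
Proof.
move=> a1 a2 size0 r0 red_card _ s alg.
have K0 := competitive_ratio_gt0 a2.
(* Dividing by the positive constant reduces the claim to a lower bound on an infimum. *)
rewrite -lee_pdivrMl//; apply: le_ereal_inf_tmp => _ [u fu <-].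
by rewrite lee_pdivrMl//; exact: (cost_le a1 size0 r0 red_card alg fu a2).
Qed.
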